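(* Let $\gamma>0$, $\tau>0$, let $N\ge 1$ be an integer, and let $\Omega$, $\Gamma_i$, $\Gamma_o$, $\mathcal{T}_h$ and the finite-element spaces $H_{h,\mathrm{imp}}(\mathrm{curl})$, $H_{h,\mathrm{imp}}(\mathrm{div})$, $H_{h,0}(\mathrm{grad})$ be as in the context. Let $(\vec E_k,\vec B_k,p_k)\in H_{h,\mathrm{imp}}(\mathrm{curl})\times H_{h,\mathrm{imp}}(\mathrm{div})\times H_{h,0}(\mathrm{grad})$, $k=0,1,\dots,N$, be the iterates of the Crank--Nicolson scheme with time step $\tau$, i.e. for every $k=1,\dots,N$ and all $(\vec F,\vec C,q)\in H_{h,\mathrm{imp}}(\mathrm{curl})\times H_{h,\mathrm{imp}}(\mathrm{div})\times H_{h,0}(\mathrm{grad})$, with the averages $\bar{\vec E}=\tfrac12(\vec E_k+\vec E_{k-1})$, $\bar{\vec B}=\tfrac12(\vec B_k+\vec B_{k-1})$, $\bar p=\tfrac12(p_k+p_{k-1})$, \begin{align*} \tfrac1\tau(\vec E_k-\vec E_{k-1},\vec F)&=-(\mathrm{grad}\,\bar p,\vec F)+(\bar{\vec B},\mathrm{curl}\,\vec F)-(1+\gamma)\int_{\Gamma_i}\langle \vec n\wedge\bar{\vec E},\vec n\wedge\vec F\rangle,\\ \tfrac1\tau(\vec B_k-\vec B_{k-1},\vec C)&=-(\mathrm{curl}\,\bar{\vec E},\vec C),\\ \tfrac1\tau(p_k-p_{k-1},q)&=(\bar{\vec E},\mathrm{grad}\,q). \end{align*} Assume that $p_0=0$ and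 that $(\vec E_0,\mathrm{grad}\,q)=0$ for all $q\in H_{h,0}(\mathrm{grad})$. Then, for all $k$, $p_k=0$ and $(\vec E_k,\mathrm{grad}\,q)=0$ for all $q\in H_{h,0}(\mathrm{grad})$.
   Context: $(\cdot,\cdot)$ is the $L^2(\Omega)$ scalar product (for scalar or vector-valued functions), $\langle\cdot,\cdot\rangle$ the Euclidean scalar product in $\mathbb{R}^3$, and $\wedge$ the cross product. $\Omega\subset\mathbb{R}^3$ is a bounded polyhedral domain approximating the region $\{1<|\vec x|<R\}$ between two spheres; its boundary has two connected components, the inner boundary $\Gamma_i$ and the outer boundary $\Gamma_o=\partial\Omega\setminus\Gamma_i$. $\vec n$ is the unit normal on $\partial\Omega$ pointing out of $\Omega$. $\mathcal{T}_h$ is a conforming partition of $\Omega$ into tetrahedra. Spaces: $H(\mathrm{curl})$ (resp. $H(\mathrm{div})$) is the space of vector fields in $(L^2(\Omega))^3$ whose curl (resp. divergence) is in $L^2$. Define $$H_{h,0}(\mathrm{grad})=\{q\in H^1_0(\Omega): q|_K \text{ is affine linear in } \vec x \text{ for all } K\in\mathcal{T}_h\},$$ $$H_{h,\mathrm{imp}}(\mathrm{div})=\{\vec C\in H(\mathrm{div}): \langle\vec C,\vec n\rangle|_{\Gamma_o}=0,\ \vec C|_K=\vec a_K+\beta_K\vec x \text{ for all } K\in\mathcal{T}_h\},$$ $$\widetilde H_{h,\mathrm{imp}}(\mathrm{curl})=\{\vec F\in H(\mathrm{curl}): \vec F\wedge\vec n|_{\Gamma_o}=0,\ \vec F|_K=\vec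 a_K+\vec b_K\wedge\vec x \text{ for all } K\in\mathcal{T}_h\},$$ where $\vec a_K,\vec b_K\in\mathbb{R}^3$ and $\beta_K\in\mathbb{R}$ are constant on each $K$. The discrete harmonic form $\mathfrak{h}^h$ is the unique continuous function on $\overline\Omega$, piecewise affine linear with respect to $\mathcal{T}_h$, with $\mathfrak{h}^h=1$ on $\Gamma_i$, $\mathfrak{h}^h=0$ on $\Gamma_o$ and $(\mathrm{grad}\,\mathfrak{h}^h,\mathrm{grad}\,q)=0$ for all $q\in H_{h,0}(\mathrm{grad})$. Finally $$H_{h,\mathrm{imp}}(\mathrm{curl})=\{\vec F\in\widetilde H_{h,\mathrm{imp}}(\mathrm{curl}): (\vec F,\mathrm{grad}\,\mathfrak{h}^h)=0\}.$$ *)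

(* Defs.v *)
From HB Require Import structures.
From mathcomp Require Import all_boot all_order all_algebra.
From mathcomp Require Import all_classical all_reals all_analysis.

Set Implicit Arguments.
Unset Strict Implicit.
Unset Printing Implicit Defensive.

Import Order.TTheory GRing.Theory Num.Theory.
Import numFieldNormedType.Exports.

Local Open Scope classical_set_scope.
Local Open Scope ring_scope.

Section EuclideanSpace.
Variable R : realType.
Local Notation vec := 'rV[R]_3.

Definition dot (u v : vec) : R := \sum_(i < 3) u 0 i * v 0 i.

(* Indices are added modulo 3. *)
Definition cross (u v : vec) : vec :=
  \row_(i < 3) (u 0 (i + 1) * v 0 (i + 2%:R) - u 0 (i + 2%:R) * v 0 (i + 1)).

Definition enorm (u : vec) : R := Num.sqrt (dot u u).

Definition partial (i : 'I_3) (f : vec -> R) : vec -> R :=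
  fun x => 'D_(delta_mx 0 i) f x.

Definition coordf (F : vec -> vec) (i : 'I_3) : vec -> R := fun x => F x 0 i.

(* Classical (pointwise) differential operators; they are only ever applied to
   smooth test functions. *)
Definition grad (f : vec -> R) : vec -> vec := fun x => \row_i partial i f x.

Definition divg (F : vec -> vec) : vec -> R :=
  fun x => \sum_(i < 3) partial i (coordf F i) x.

Definition curl (F : vec -> vec) : vec -> vec := fun x =>
  \row_(i < 3) (partial (i + 1) (coordf F (i + 2%:R)) x
                - partial (i + 2%:R) (coordf F (i + 1)) x).

Definition smooth (f : vec -> R) : Prop :=
  forall s : seq 'I_3, let g := foldr partial f s in
    continuous g /\ forall x (i : 'I_3), derivable g x (delta_mx 0 i).

(* 'rV[R]_3 carries no sigma-algebra in the library: integrals over R^3 are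
   taken with the product Lebesgue measure on R * R * R. *)
Local Notation mR := (measurableTypeR R).
Local Notation mu := (@lebesgue_measure R).

Definition leb2 : set (mR * mR) -> \bar R := (mu \x mu)%E.

HB.instance Definition _ := Measure.on leb2.

Lemma leb2_sigma_finite : sigma_finite setT leb2.
Proof.
have /sigma_finiteP[F [TF ndF Foo]] := sigma_finiteT mu.
exists (fun n => F n `*` F n).
  rewrite -setXTT TF predeqE => -[x y]; split.
    move=> [/= [n _ Fnx] [k _ Gky]]; exists (maxn n k) => //; split.
    - by move: x Fnx; exact/subsetPset/ndF/leq_maxl.
    - by move: y Gky; exact/subsetPset/ndF/leq_maxr.
  by move=> [n _ []/= ? ?]; split; exists n.
move=> k; have [mF Fk] := Foo k; split; first exact: measurableX.
by rewrite /leb2 product_measure1E// lte_mul_pinfty// ge0_fin_numE.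
Qed.

HB.instance Definition _ :=
  Measure_isSigmaFinite.Build _ _ _ leb2 leb2_sigma_finite.

Definition leb3 : set (mR * mR * mR) -> \bar R := (leb2 \x mu)%E.

HB.instance Definition _ := Measure.on leb3.

Definition pt (y : R * R * R) : vec := \row_(i < 3) [:: y.1.1; y.1.2; y.2]`_i.

End EuclideanSpace.

Section SobolevSpaces.
Variables (R : realType) (Om : set 'rV[R]_3).
Local Notation vec := 'rV[R]_3.

Definition L2 (f : vec -> R) : Prop :=
  (f \o @pt R) \_ (@pt R @^-1` Om) \in Lfun (@leb3 R) 2%:E.

Definition L2v (F : vec -> vec) : Prop := forall i, L2 (coordf F i).

Definition ip (f g : vec -> R) : R :=
  \int[@leb3 R]_(y in @pt R @^-1` Om) (f (pt y) * g (pt y)).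

Definition ipv (F G : vec -> vec) : R :=
  \int[@leb3 R]_(y in @pt R @^-1` Om) dot (F (pt y)) (G (pt y)).

Definition test_fun (phi : vec -> R) : Prop :=
  smooth phi /\
  exists A, [/\ compact A, A `<=` Om & forall x, ~ A x -> phi x = 0].

Definition test_field (Phi : vec -> vec) : Prop :=
  forall i, test_fun (coordf Phi i).

Definition is_wgrad (f : vec -> R) (G : vec -> vec) : Prop :=
  L2v G /\ forall Phi, test_field Phi -> ip f (divg Phi) = - ipv G Phi.

Definition is_wdiv (F : vec -> vec) (g : vec -> R) : Prop :=
  L2 g /\ forall phi, test_fun phi -> ipv F (grad phi) = - ip g phi.

Definition is_wcurl (F G : vec -> vec) : Prop :=
  L2v G /\ forall Phi, test_field Phi -> ipv F (curl Phi) = ipv G Phi.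

(* A representative of the (a.e. unique) weak gradient and weak curl. *)
Definition wgrad (f : vec -> R) : vec -> vec := get (is_wgrad f).
Definition wcurl (F : vec -> vec) : vec -> vec := get (is_wcurl F).

Definition H1 (f : vec -> R) : Prop := L2 f /\ exists G, is_wgrad f G.
Definition Hdiv (F : vec -> vec) : Prop := L2v F /\ exists g, is_wdiv F g.
Definition Hcurl (F : vec -> vec) : Prop := L2v F /\ exists G, is_wcurl F G.

(* Closure of the test functions in the H^1 norm. *)
Definition H10 (f : vec -> R) : Prop :=
  H1 f /\ exists phi : nat -> vec -> R,
    [/\ forall n, test_fun (phi n),
        ip (f \- phi n) (f \- phi n) @[n --> \oo] --> (0 : R) &
        ipv (wgrad f \- grad (phi n)) (wgrad f \- grad (phi n))
          @[n --> \oo] --> (0 : R)].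

End SobolevSpaces.

Section Geometry.
Variable R : realType.
Local Notation vec := 'rV[R]_3.

Definition bdry (Om : set vec) : set vec := closure Om `\` Om°.

(* The points outside [closure Om] that can be joined to infinity. *)
Definition exterior (Om : set vec) : set vec :=
  [set x | ~ bounded_set (connected_component (~` closure Om) x)].

(* A bounded domain whose boundary has exactly two connected components, the
   inner one [Gi] and the outer one [bdry Om `\` Gi]. *)
Record shell (Om Gi : set vec) : Prop := Shell {
  shell_open : open Om;
  shell_connected : connected Om;
  shell_bounded : bounded_set Om;
  shell_inner_neq0 : Gi !=set0;
  shell_outer_neq0 : bdry Om `\` Gi !=set0;
  shell_inner_component :
    forall x, Gi x -> connected_component (bdry Om) x = Gi;
  shell_outer_component : forall x, (bdry Om `\` Gi) x ->
    connected_component (bdry Om) x = bdry Om `\` Gi;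
  shell_inner : Gi `&` closure (exterior Om) = set0;
  shell_outer : bdry Om `\` Gi `<=` closure (exterior Om) }.

(* Convex hull of the vertices [v i], [i \in S]; empty when [S] is. *)
Definition hull (v : 'I_4 -> vec) (S : {set 'I_4}) : set vec :=
  [set x | exists w : 'I_4 -> R,
    [/\ forall i, 0 <= w i, forall i, i \notin S -> w i = 0,
        \sum_(i < 4) w i = 1 & x = \sum_(i < 4) w i *: v i]].

Definition tet (v : 'I_4 -> vec) : set vec := hull v [set: 'I_4]%SET.
Definition face (v : 'I_4 -> vec) (i : 'I_4) : set vec := hull v [set~ i]%SET.

Definition nondegenerate (v : 'I_4 -> vec) : Prop :=
  \matrix_(i < 3) (v (lift ord0 i) - v ord0) \in unitmx.

(* [T K] lists the vertices of the tetrahedron of index [K]. The condition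
   [(closure Om)° = Om] rules out slits, which no polyhedral domain has. *)
Record conforming (Om : set vec) (I : finType) (T : I -> 'I_4 -> vec) : Prop :=
  Conforming {
  conf_nondegenerate : forall K, nondegenerate (T K);
  conf_cover : closure Om = \bigcup_K tet (T K);
  conf_regular : (closure Om)° = Om;
  conf_disjoint :
    forall K L, K != L -> (tet (T K))° `&` (tet (T L))° = set0;
  conf_faces : forall K L, K != L -> exists S S',
    tet (T K) `&` tet (T L) = hull (T K) S /\
    tet (T K) `&` tet (T L) = hull (T L) S' }.

(* [v (lift i k)], k = 0, 1, 2, are the vertices of the face opposite [v i]. *)
Definition edge1 (v : 'I_4 -> vec) (i : 'I_4) : vec :=
  v (lift i 1) - v (lift i 0).
Definition edge2 (v : 'I_4 -> vec) (i : 'I_4) : vec :=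
  v (lift i 2%:R) - v (lift i 0).
Definition area_vec (v : 'I_4 -> vec) (i : 'I_4) : vec :=
  cross (edge1 v i) (edge2 v i).

(* Unit normal of the face opposite [v i], pointing out of the tetrahedron. *)
Definition face_normal (v : 'I_4 -> vec) (i : 'I_4) : vec :=
  (Num.sg (dot (area_vec v i) (v (lift i 0) - v i)) / enorm (area_vec v i))
    *: area_vec v i.

(* Surface integral over that face, parametrised over the unit triangle. *)
Definition face_integral (v : 'I_4 -> vec) (i : 'I_4) (g : vec -> R) : R :=
  enorm (area_vec v i) *
  \int[@leb2 R]_(y in [set y | [/\ 0 <= y.1, 0 <= y.2 & y.1 + y.2 <= 1]])
    g (v (lift i 0) + y.1 *: edge1 v i + y.2 *: edge2 v i).

(* Trace at [x] of a field from inside the tetrahedron. *)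
Definition inner_trace (v : 'I_4 -> vec) (F : vec -> vec) (x : vec) : vec :=
  lim (F @ within (tet v)° (nbhs x)).

End Geometry.

Section FiniteElements.
Variables (R : realType) (Om Gi : set 'rV[R]_3).
Variables (I : finType) (T : I -> 'I_4 -> 'rV[R]_3).
Local Notation vec := 'rV[R]_3.
Local Notation Go := (bdry Om `\` Gi).

Definition affine_on (A : set vec) (q : vec -> R) : Prop :=
  exists a b, forall x, A x -> q x = dot a x + b.

Definition H0_grad (q : vec -> R) : Prop :=
  H10 Om q /\ forall K, affine_on (tet (T K)) q.

(* Vector fields may jump across faces, so that their local form is imposed in
   the interior of the tetrahedra. *)
Definition Himp_div (C : vec -> vec) : Prop :=
  [/\ Hdiv Om C,
      forall K i x, face (T K) i `<=` Go -> face (T K) i x ->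
        dot (inner_trace (T K) C x) (face_normal (T K) i) = 0 &
      forall K, exists a (beta : R),
        forall x, (tet (T K))° x -> C x = a + beta *: x].

Definition Himp_curl_tilde (F : vec -> vec) : Prop :=
  [/\ Hcurl Om F,
      forall K i x, face (T K) i `<=` Go -> face (T K) i x ->
        cross (inner_trace (T K) F x) (face_normal (T K) i) = 0 &
      forall K, exists a b,
        forall x, (tet (T K))° x -> F x = a + cross b x].

Definition discrete_harmonic (h : vec -> R) : Prop :=
  [/\ {within closure Om, continuous h},
      forall K, affine_on (tet (T K)) h,
      forall x, Gi x -> h x = 1,
      forall x, Go x -> h x = 0 &
      forall q, H0_grad q -> ipv Om (wgrad Om h) (wgrad Om q) = 0].

Definition Himp_curl (h : vec -> R) (F : vec -> vec) : Prop :=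
  Himp_curl_tilde F /\ ipv Om F (wgrad Om h) = 0.

(* The integral over [Gi] of <n /\ E, n /\ F>. *)
Definition impedance (E F : vec -> vec) : R :=
  \sum_(f : I * 'I_4 | `[< face (T f.1) f.2 `<=` Gi >])
    face_integral (T f.1) f.2 (fun x =>
      dot (cross (face_normal (T f.1) f.2) (inner_trace (T f.1) E x))
          (cross (face_normal (T f.1) f.2) (inner_trace (T f.1) F x))).

Definition crank_nicolson_step (h : vec -> R) (gamma tau : R)
    (E0 B0 : vec -> vec) (p0 : vec -> R)
    (E1 B1 : vec -> vec) (p1 : vec -> R) : Prop :=
  let Em : vec -> vec := fun x => 2^-1 *: (E1 x + E0 x) in
  let Bm : vec -> vec := fun x => 2^-1 *: (B1 x + B0 x) in
  let pm : vec -> R := fun x => 2^-1 * (p1 x + p0 x) in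
  forall F C q, Himp_curl h F -> Himp_div C -> H0_grad q ->
  [/\ tau^-1 * ipv Om (E1 \- E0) F =
        - ipv Om (wgrad Om pm) F + ipv Om Bm (wcurl Om F)
        - (1 + gamma) * impedance Em F,
      tau^-1 * ipv Om (B1 \- B0) C = - ipv Om (wcurl Om Em) C &
      tau^-1 * ip Om (p1 \- p0) q = ipv Om Em (wgrad Om q)].

End FiniteElements.

(* Main.v *)
(* Let G be the piecewise constant gradient of some q in H0_grad. Its weak curl
   vanishes, and so does its tangential trace on the boundary because q is zero
   there; it is orthogonal to the gradient of the discrete harmonic form. Hence G
   is an admissible test field, and with it the first equation of the scheme
   loses its curl and boundary terms, leaving (E_k - E_(k-1), G) = - tau (grad pm, G)
   where pm = (p_k + p_(k-1)) / 2.
   Suppose p_(k-1) = 0 and E_(k-1) is discretely divergence free. Taking q = p_k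
   here and in the third equation gives
     (p_k, p_k) = tau / 2 (E_k, grad p_k)
                = - tau^2 / 4 (grad p_k, grad p_k) <= 0,
   so that p_k = 0, and then (E_k, grad q) = 0 for every q. *)

Require Import Defs.
From mathcomp Require Import all_boot all_order all_algebra.
From mathcomp Require Import all_classical all_reals all_analysis.
From mathcomp Require Import measurable_realfun ring lra.
Set Implicit Arguments.
Unset Strict Implicit.
Unset Printing Implicit Defensive.
Import Order.TTheory GRing.Theory Num.Theory.
Import numFieldNormedType.Exports.
Local Open Scope classical_set_scope.
Local Open Scope ring_scope.

(** Two phrases of the overview hide the real work. That q is zero on the boundary is not part of
    [H0_grad]: [H10] is a closure in the H^1 norm and says nothing about point values. Vanishing is
    recovered from the approximating test functions by a Poincaré estimate along a coordinate
    segment that leaves [closure Om] close to the given boundary point. That G is the gradient of q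
    holds only up to null sets, since [wgrad] and [wcurl] are arbitrary representatives, while
    traces and the local forms are pointwise. Every exchange of representatives is therefore made
    inside an inner product: a field orthogonal to all test functions of each open tetrahedron is
    orthogonal to everything piecewise smooth. This requires explicit test functions, built from
    exp(-1/t) and the barycentric coordinates, and the fact that the planes of the faces are null.
    Both arguments rest on one-dimensional calculus carried to space by Tonelli along coordinate
    lines. *)

(** * Row vectors against the product space: coordinates, boxes, measurability *)

Section PointsOfSpace.
Variable R : realType.
Local Notation vec := 'rV[R]_3.
Local Notation mR := (measurableTypeR R).
Local Notation mu := (@lebesgue_measure R).
Local Notation X := (mR * mR * mR)%type.

Lemma sum3 (V : nmodType) (f : 'I_3 -> V) :
  \sum_(i < 3) f i = f 0 + f 1 + f 2%:R.
Proof.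
by rewrite 3!big_ord_recr big_ord0 /= add0r; congr (f _ + f _ + f _);
  exact: val_inj.
Qed.

Lemma ord3P (P : 'I_3 -> Prop) : P 0 -> P 1 -> P 2%:R -> forall i, P i.
Proof.
by move=> P0 P1 P2 [[|[|[|//]]] j]; [move: P0|move: P1|move: P2];
  congr (P _); exact: val_inj.
Qed.

Lemma dotC (u v : vec) : dot u v = dot v u.
Proof. by apply: eq_bigr => i _; rewrite mulrC. Qed.

Lemma dotDr (u v w : vec) : dot u (v + w) = dot u v + dot u w.
Proof. by rewrite /dot -big_split; apply: eq_bigr => i _; rewrite mxE mulrDr. Qed.

Lemma dotZr (a : R) (u v : vec) : dot u (a *: v) = a * dot u v.
Proof. by rewrite /dot big_distrr; apply: eq_bigr => i _; rewrite mxE mulrCA. Qed.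

Lemma dot0r (u : vec) : dot u 0 = 0.
Proof. by rewrite /dot big1// => i _; rewrite mxE mulr0. Qed.

Lemma dot0l (u : vec) : dot 0 u = 0.
Proof. by rewrite dotC dot0r. Qed.

Lemma dotBr (u v w : vec) : dot u (v - w) = dot u v - dot u w.
Proof. by rewrite dotDr -scaleN1r dotZr mulN1r. Qed.

Lemma dot_delta (u : vec) i : dot u (delta_mx 0 i) = u 0 i.
Proof.
rewrite /dot (bigD1 i)//= mxE !eqxx mulr1 big1 ?addr0// => j ji.
by rewrite mxE eqxx (negPf ji) mulr0.
Qed.

Lemma dot_cvg (u : vec) : continuous (dot u).
Proof.
move=> x; rewrite /dot.
rewrite (_ : (fun _ => _) = fun v : vec =>
  u 0 0 * v 0 0 + u 0 1 * v 0 1 + u 0 2%:R * v 0 2%:R); last first.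
  by apply/funext => v; rewrite sum3.
have H i : (fun v : vec => u 0 i * v 0 i) @ x --> u 0 i * x 0 i.
  apply: (@cvgM _ _ (nbhs x) _ (cst (u 0 i)) (fun v : vec => v 0 i)).
    exact: cvg_cst.
  exact: coord_continuous.
exact: cvgD (cvgD (H _) (H _)) (H _).
Qed.

Lemma pt0 (y : X) : pt y 0 0 = y.1.1. Proof. by rewrite mxE. Qed.
Lemma pt1 (y : X) : pt y 0 1 = y.1.2. Proof. by rewrite mxE. Qed.
Lemma pt2 (y : X) : pt y 0 2%:R = y.2. Proof. by rewrite mxE. Qed.
Definition ptE := (pt0, pt1, pt2).

Definition tp (x : vec) : X := (x 0 0, x 0 1, x 0 2%:R).

Lemma tpK x : pt (tp x) = x.
Proof. by apply/rowP; apply: ord3P; rewrite ptE. Qed.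

(** The coordinate line through x, parametrised by the coordinate itself and not by an increment, so
    that partial derivatives and the slices of iterated integrals live on the same line. *)
Definition upd (x : vec) (i : 'I_3) (s : R) : vec :=
  \row_j (if j == i then s else x 0 j).

Lemma upd_shift x i s t : upd x i (t + s) = t *: delta_mx 0 i + upd x i s.
Proof.
apply/rowP => j; rewrite !mxE /=; case: eqVneq => _; first by rewrite mulr1.
by rewrite mulr0 add0r.
Qed.

Lemma upd_self x i : upd x i (x 0 i) = x.
Proof. by apply/rowP => j; rewrite mxE; case: eqP => // ->. Qed.

Lemma upd_upd x i s t : upd (upd x i s) i t = upd x i t.
Proof. by apply/rowP => j; rewrite !mxE; case: eqP. Qed.

Lemma updE x i s : upd x i s 0 i = s. Proof. by rewrite mxE eqxx. Qed.

Lemma upd_continuous x i : continuous (upd x i).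
Proof.
move=> s; rewrite (_ : upd x i = fun t => (t - s) *: delta_mx 0 i + upd x i s).
  apply: cvgD; last exact: cvg_cst.
  apply: cvgZr_tmp; apply: cvgB; [exact: cvg_id|exact: cvg_cst].
by apply/funext => t; rewrite -upd_shift subrK.
Qed.

Lemma tp_upd0 (a b c s : R) : tp (upd (pt (a, b, c)) 0 s) = (s, b, c).
Proof. by rewrite /tp !mxE. Qed.

Lemma tp_upd1 (a b c s : R) : tp (upd (pt (a, b, c)) 1 s) = (a, s, c).
Proof. by rewrite /tp !mxE. Qed.

Lemma tp_upd2 (a b c s : R) : tp (upd (pt (a, b, c)) 2%:R s) = (a, b, s).
Proof. by rewrite /tp !mxE. Qed.

Lemma ball3P (c : vec) (e : R) x : 0 < e ->
  ball c e x <-> forall i, `|c 0 i - x 0 i| < e.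
Proof.
move=> e0; split => [[_ H] i|H]; first exact: H.
by split => // i j; rewrite (ord1 i); exact: H.
Qed.

Lemma ler_mx_coord (x : vec) i : `|x 0 i| <= `|x|.
Proof.
rewrite [leRHS]mx_normrE; exact: (le_bigmax _ (fun ij => `|x ij.1 ij.2|) (0, i)).
Qed.

Definition box (c : vec) (e : 'I_3 -> R) : set vec :=
  [set x | forall j, `|c 0 j - x 0 j| < e j].

Lemma ball_box (c : vec) (e : R) : 0 < e -> ball c e = box c (fun=> e).
Proof. by move=> e0; apply/seteqP; split => x /(ball3P _ _ e0). Qed.

Lemma pt_box (c : vec) (e : 'I_3 -> R) :
  (@pt R : X -> vec) @^-1` box c e =
  (ball (c 0 0) (e 0) `*` ball (c 0 1) (e 1)) `*` ball (c 0 2%:R) (e 2%:R).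
Proof.
apply/seteqP; split => y /=.
  by move=> h; split; [split|]; rewrite -?ptE; exact: h.
by move=> [[h0 h1] h2]; apply: ord3P; rewrite ptE.
Qed.

Lemma measurable_pt_box (c : vec) (e : 'I_3 -> R) :
  measurable ((@pt R : X -> vec) @^-1` box c e).
Proof.
have mb (r d : R) : measurable (ball r d : set mR).
  by rewrite ball_itv; exact: measurable_itv.
by rewrite pt_box//; apply: measurableX => //; exact: measurableX.
Qed.

Lemma leb3_box (c : vec) (e : 'I_3 -> R) : (forall j, 0 < e j) ->
  leb3 ((@pt R : X -> vec) @^-1` box c e) = (\prod_j (e j *+ 2))%:E.
Proof.
move=> e0.
have mb (r d : R) : measurable (ball r d : set mR).
  by rewrite ball_itv; exact: measurable_itv.
have me (r : R) j : mu (ball r (e j)) = (e j *+ 2)%:E.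
  by apply: lebesgue_measure_ball; exact: ltW.
rewrite pt_box//.
have E2 : @leb2 R (ball (c 0 0) (e 0) `*` ball (c 0 1) (e 1)) =
    ((e 0 *+ 2) * (e 1 *+ 2))%:E.
  rewrite /leb2 product_measure1E// [X in (X * _)%E]me [X in (_ * X)%E]me.
  by rewrite -EFinM.
rewrite /leb3 product_measure1E//; last exact: measurableX.
rewrite [X in (X * _)%E]E2 [X in (_ * X)%E]me -EFinM; congr EFin.
rewrite !big_ord_recr big_ord0 /= mul1r.
by congr (_ * _ * _); congr (e _ *+ 2); exact: val_inj.
Qed.

(** An open set is the union of the countably many balls it contains with rational centre and radius
    [n.+1%:R^-1]; the norm being the maximum norm, each of them pulls back to a product of three
    intervals. *)
Lemma pt_measurable (O : set vec) : open O ->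
  measurable ((@pt R : X -> vec) @^-1` O).
Proof.
move=> oO.
pose cen (q : rat * rat * rat) : vec :=
  pt (ratr q.1.1 : R, ratr q.1.2 : R, ratr q.2 : R).
pose P (k : rat * rat * rat * nat) := ball (cen k.1) k.2.+1%:R^-1 `<=` O.
rewrite (_ : _ @^-1` _ =
  \bigcup_(k in P) (@pt R @^-1` ball (cen k.1) k.2.+1%:R^-1)); last first.
  apply/seteqP; split => [y /= Oy|y [k Pk /Pk]//].
  have /nbhs_ballP[e /= e0 eO] : nbhs (pt y) O by apply: open_nbhs_nbhs.
  have [n ne] : exists n, n.+1%:R^-1 < e / 2.
    have [n _ /(_ n (leqnn _)) ne] := near_infty_natSinv_lt (PosNum (divr_gt0 e0 (ltr0Sn R 1))).
    by exists n.
  have n0 : 0 < n.+1%:R^-1 :> R by [].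
  have app (r : R) : exists q : rat, `|ratr q - r| < n.+1%:R^-1.
    have rr : r - n.+1%:R^-1 < r + n.+1%:R^-1 by rewrite ltrD2l (lt_trans _ n0)// oppr_lt0.
    have [q /[!in_itv]/= /andP[q1 q2]] := rat_in_itvoo rr.
    by exists q; rewrite ltr_distl q1 q2.
  have [q0 hq0] := app y.1.1; have [q1 hq1] := app y.1.2.
  have [q2 hq2] := app y.2.
  have hb : ball (cen (q0, q1, q2)) n.+1%:R^-1 (pt y).
    by apply/ball3P => //; apply: ord3P; rewrite !ptE.
  exists (q0, q1, q2, n) => //.
  move=> z zb; apply: eO; rewrite (splitr e); apply: (@ball_triangle _ _ (cen (q0, q1, q2)) _ _ (e/2) (e/2)).
    by apply: ball_sym; apply: le_ball hb; exact: ltW.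
  by apply: le_ball zb; exact: ltW.
rewrite bigcup_mkcond; apply: countable_bigcupT_measurable.
  exact: countableP.
by move=> k; case: ifP => // _; rewrite ball_box//; exact: measurable_pt_box.
Qed.

Lemma pt_measurable_closed (A : set vec) : closed A ->
  measurable ((@pt R : X -> vec) @^-1` A).
Proof.
move=> cA; rewrite -[A]setCK -preimage_setC; apply: measurableC.
by apply: pt_measurable; exact: closed_openC.
Qed.

Lemma pt_measurable_fun (f : vec -> R) : continuous f ->
  measurable_fun setT ((f \o @pt R) : X -> mR).
Proof.
move=> cf; apply: (measurability _ (RGenOInfty.measurableE R)) => //.
move=> _ [_ [r ->] <-]; rewrite setTI comp_preimage.
by apply: pt_measurable; apply: open_comp => [x _|]; [exact: cf|exact: rray_open].
Qed.

End PointsOfSpace.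

(** * The smooth function exp(-1/t) and the family of its derivatives *)

Section FlatExponential.
Variable R : realType.

Definition flat (m : nat) (t : R) : R :=
  if 0 < t then t^-1 ^+ m * expR (- t^-1) else 0.

Lemma flat_le0 m t : t <= 0 -> flat m t = 0.
Proof. by rewrite /flat => t0; rewrite ltNge t0. Qed.

Lemma flat_ge0 m t : 0 <= flat m t.
Proof.
rewrite /flat; case: ifP => // t0.
by rewrite mulr_ge0 ?expR_ge0// exprn_ge0// invr_ge0 ltW.
Qed.

(** With y = 1/t and n = m + 2, [expR (y / n) >= y / n] raised to the power n gives
    [y ^ n <= n ^ n * expR y]; dividing by [y ^ 2 * expR y] leaves the bound. Order 2 in t is what
    makes the derivative at the origin vanish. *)
Lemma flat_quadratic m t : `|flat m t| <= m.+2%:R ^+ m.+2 * t ^+ 2.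
Proof.
rewrite ger0_norm ?flat_ge0// /flat; case: ifP => [t0|_]; last first.
  by rewrite mulr_ge0 ?sqr_ge0// exprn_ge0.
set n := m.+2; pose y := t^-1.
have y0 : 0 < y by rewrite invr_gt0.
have n0 : 0 < n%:R :> R by rewrite ltr0n.
have h : y ^+ n <= n%:R ^+ n * expR y.
  have -> : expR y = expR (y / n%:R) ^+ n.
    by rewrite -expRM_natl mulrC divfK// gt_eqF.
  rewrite -exprMn lerXn2r ?nnegrE ?(ltW y0)//.
  rewrite mulrC -ler_pdivrMr//; apply: le_trans (expR_ge1Dx _).
  by rewrite lerDr.
rewrite -/y expRN ler_pdivrMr ?expR_gt0//.
rewrite -(ler_pM2r (_ : 0 < y ^+ 2)) ?exprn_gt0// -exprD addn2 -/n.
apply: le_trans h _; rewrite le_eqVlt; apply/orP; left; apply/eqP.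
rewrite /y; field; exact: lt0r_neq0.
Qed.

Lemma is_derive_flat m (t : R) :
  is_derive t (1 : R) (flat m) (- m%:R * flat m.+1 t + flat m.+2 t).
Proof.
have [t0|t0|->] := ltgtP t 0.
- rewrite !flat_le0 ?ltW// mulr0 addr0.
  apply: (@near_eq_is_derive _ _ _ (cst 0)).
  by near=> s; rewrite flat_le0// ltW//; near: s; exact: lt_nbhsl.
- apply: (@near_eq_is_derive R R^o R^o (fun s : R => s^-1 ^+ m * expR (- s^-1))).
    near=> s; rewrite /flat ifT//; near: s; exact: lt_nbhsr.
  have tn0 : t != 0 by rewrite gt_eqF.
  have d1 : is_derive t 1 (fun s : R => s^-1) (- t ^- 2).
    by apply: is_derive_eq; [exact: is_deriveV|rewrite /GRing.scale/= mulr1].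
  have d2 : is_derive t 1 (fun s : R => expR (- s^-1)) (t ^- 2 * expR (- t^-1)).
    have dN : is_derive t (1 : R) (fun s : R => - s^-1) (t ^- 2).
      by rewrite -[t ^- 2]opprK; exact: is_deriveN.
    have H := @is_derive1_comp R expR (fun s : R => - s^-1) t _ _ (is_derive_expR (- t^-1)) dN.
    by apply: (is_derive_eq H); rewrite mulrC.
  have d3 : is_derive t 1 (fun s : R => s^-1 ^+ m) (- m%:R * t^-1 ^+ m.+1).
    elim: m => [|m IHm]; first by rewrite oppr0 mul0r; exact: is_derive_cst.
    rewrite (_ : (fun _ => _) = (fun s : R => s^-1) * (fun s => s^-1 ^+ m)).
      apply: (is_derive_eq (is_deriveM d1 IHm)).
      by rewrite /GRing.scale/= -exprVn !exprS; ring.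
    by apply/funext => s; rewrite exprS.
  apply: (is_derive_eq (is_deriveM d3 d2)).
  rewrite /flat t0 /GRing.scale/= -!exprVn !exprS; ring.
(* At the origin the difference quotient is at most [C * |h|] by [flat_quadratic]. *)
- rewrite !flat_le0// mulr0 addr0.
  set C : R := m.+2%:R ^+ m.+2.
  have C0 : 0 < C by rewrite exprn_gt0// ltr0n.
  have lim0 : h^-1 *: ((flat m \o shift 0) (h *: (1 : R)) - flat m 0)
      @[h --> 0^'] --> (0 : R).
    apply/cvgrPdist_lt => e e0; near=> h.
    have h0 : h != 0 by near: h; exact: nbhs_dnbhs_neq.
    rewrite sub0r normrN /= [flat m 0]flat_le0// subr0 /GRing.scale/= mulr1 addr0.
    rewrite normrM normfV mulrC ltr_pdivrMr ?normr_gt0//.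
    apply: (le_lt_trans (flat_quadratic m h)).
    rewrite -real_normK ?num_real// expr2 mulrA ltr_pM2r ?normr_gt0//.
    rewrite mulrC -ltr_pdivlMr//; near: h; apply: dnbhs0_lt.
    exact: divr_gt0.
  by apply: DeriveDef; [apply/cvg_ex; exists 0|exact: cvg_lim].
Unshelve. all: by end_near. Qed.

End FlatExponential.

(** * Smooth functions: restriction to coordinate lines, closure properties, Schwarz's theorem *)

Section Lines.
Variable R : realType.
Local Notation vec := 'rV[R]_3.

(** The difference quotient in direction i is literally that of the one-variable restriction, so
    that the chain rule, the mean value theorem and the fundamental theorem of calculus carry
    over. *)
Let quot_line (f : vec -> R) x i :
  (fun h : R => h^-1 *: ((f \o shift x) (h *: (delta_mx 0 i : vec)) - f x)) =
  (fun h : R => h^-1 *: (((fun s => f (upd x i s)) \o shift (x 0 i)) (h *: 1)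
     - (fun s => f (upd x i s)) (x 0 i))).
Proof.
apply/funext => h; rewrite /= upd_self; congr (_ *: (f _ - _)).
rewrite /shift/=; apply/rowP => j; rewrite !mxE /=; case: eqVneq => [->|_].
  by rewrite mulr1 /GRing.scale/= mulr1.
by rewrite mulr0 add0r.
Qed.

Lemma derivable_line (f : vec -> R) x i :
  derivable f x (delta_mx 0 i) = derivable (fun s => f (upd x i s)) (x 0 i) 1.
Proof. by rewrite /derivable quot_line. Qed.

Lemma partial_line (f : vec -> R) x i :
  partial i f x = 'D_1 (fun s => f (upd x i s)) (x 0 i).
Proof. by rewrite /partial /derive quot_line. Qed.

Lemma is_derive_line (f : vec -> R) (x : vec) i (s : R) :
  derivable f (upd x i s) (delta_mx 0 i) ->
  is_derive s (1 : R) (fun t => f (upd x i t)) (partial i f (upd x i s)).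
Proof.
rewrite derivable_line partial_line updE.
rewrite (_ : (fun _ => _) = fun t => f (upd x i t)).
  by move=> d; apply: DeriveDef.
by apply/funext => t; rewrite upd_upd.
Qed.

Lemma is_derive_partial (f : vec -> R) (x : vec) i (d : R) :
  is_derive (x 0 i) (1 : R) (fun s => f (upd x i s)) d ->
  derivable f x (delta_mx 0 i) /\ partial i f x = d.
Proof. by move=> [h <-]; rewrite derivable_line partial_line. Qed.

Lemma continuous_line (f : vec -> R) x i :
  continuous f -> continuous (fun s => f (upd x i s)).
Proof.
by move=> cf s; apply: continuous_comp; [exact: upd_continuous|exact: cf].
Qed.

Lemma partialE i (f : vec -> R) x : partial i f x = 'D_(delta_mx 0 i) f x.
Proof. by []. Qed.

#[local] Opaque partial upd.

Lemma smoothC (f : vec -> R) : smooth f -> continuous f.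
Proof. by rewrite /smooth => /(_ [::]) []. Qed.

Lemma smooth_derivable (f : vec -> R) x i :
  smooth f -> derivable f x (delta_mx 0 i).
Proof. by rewrite /smooth => /(_ [::]) [_]; exact. Qed.

Lemma smooth_partial i (f : vec -> R) : smooth f -> smooth (partial i f).
Proof. by rewrite /smooth => sf s; have := sf (rcons s i); rewrite foldr_rcons. Qed.

(** A coinduction principle: [smooth] speaks of all iterated partial derivatives, and an invariant
    class P contains them all by induction on their sequence. *)
Lemma smooth_closed (P : (vec -> R) -> Prop) :
  (forall f, P f -> continuous f) ->
  (forall f i, P f ->
    (forall x, derivable f x (delta_mx 0 i)) /\ P (partial i f)) ->
  forall f, P f -> smooth f.
Proof.
move=> Pc Pd f Pf; rewrite /smooth => s; set g := foldr _ _ _.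
suff Pg : P g by split; [exact: Pc|move=> x i; exact: (Pd g i Pg).1].
by rewrite {}/g; elim: s => //= i s /(Pd _ i)[].
Qed.

(* As flat m has derivative - m * flat m.+1 + flat m.+2, this class is stable
   under partial derivatives. *)
Inductive smooth_expr : (vec -> R) -> Prop :=
| SmoothAtom f of smooth f : smooth_expr f
| SmoothCst (c : R) : smooth_expr (fun=> c)
| SmoothAffine (a : vec) (b : R) : smooth_expr (fun x => dot a x + b)
| SmoothFlat m (a : vec) (b : R) : smooth_expr (fun x => flat m (dot a x + b))
| SmoothD f g of smooth_expr f & smooth_expr g : smooth_expr (fun x => f x + g x)
| SmoothM f g of smooth_expr f & smooth_expr g : smooth_expr (fun x => f x * g x).

Lemma flat_continuous m : continuous (@flat R m).
Proof.
move=> t; apply: differentiable_continuous; apply/derivable1_diffP.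
exact: (@ex_derive _ _ _ _ _ _ _ (is_derive_flat m t)).
Qed.

Lemma affine_continuous (a : vec) (b : R) : continuous (fun x => dot a x + b).
Proof. by move=> x; exact: (cvgD (@dot_cvg R a x) (cvg_cst b)). Qed.

Lemma is_derive_affine_line (a x : vec) (b : R) i :
  is_derive (x 0 i) (1 : R) (fun s => dot a (upd x i s) + b) (a 0 i).
Proof.
rewrite (_ : (fun _ => _) = fun s => s * a 0 i + (dot a (upd x i 0) + b)).
  apply: is_derive_eq; rewrite addr0 ?scaler0 ?add0r ?/GRing.scale/= ?mulr1//.
apply/funext => s; rewrite addrA; congr (_ + b).
by rewrite -[s in LHS]addr0 upd_shift dotDr dotZr dot_delta.
Qed.

#[local] Opaque smooth.

Lemma smooth_expr_smooth f : smooth_expr f -> smooth f.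
Proof.
apply: smooth_closed => {f} f; last move=> i.
  elim => {f} [f|c|a b|m a b|f g _ cf _ cg|f g _ cf _ cg].
  - exact: smoothC.
  - exact: cst_continuous.
  - exact: affine_continuous.
  - move=> x; apply: (@continuous_comp _ _ _ (fun y => dot a y + b) (flat m)).
      exact: affine_continuous.
    exact: flat_continuous.
  - by move=> x; exact: (cvgD (cf x) (cg x)).
  - by move=> x; exact: (cvgM (cf x) (cg x)).
elim => {f} [f sf|c|a b|m a b|f g sf [df pf] sg [dg pg]|f g sf [df pf] sg [dg pg]].
- split; [by move=> x; exact: smooth_derivable|].
  by apply/SmoothAtom/smooth_partial.
- split; [by move=> x; exact: derivable_cst|].
  rewrite (_ : partial _ _ = fun=> 0); first exact: SmoothCst.
  by apply/funext => x; rewrite !partialE derive_cst.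
- have H x := @is_derive_partial (fun y => dot a y + b) x i _
    (is_derive_affine_line a x b i).
  split=> [x|]; first exact: (H x).1.
  rewrite (_ : partial _ _ = fun=> a 0 i); first exact: SmoothCst.
  by apply/funext => x; exact: (H x).2.
- have H (x : vec) : is_derive (x 0 i) (1 : R) (fun s : R => flat m (dot a (upd x i s) + b))
      (a 0 i * (- m%:R * flat m.+1 (dot a x + b) + flat m.+2 (dot a x + b))).
    have d1 := is_derive_affine_line a x b i.
    have d2 := is_derive_flat m (dot a x + b).
    rewrite mulrC; apply: (@is_derive1_comp _ (flat m) (fun s => dot a (upd x i s) + b)).
    by rewrite upd_self.
  split=> [x|]; first exact: (@is_derive_partial (fun y => flat m (dot a y + b)) x i _ (H x)).1.
  rewrite (_ : partial _ _ = fun x => (fun=> a 0 i) x *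
    ((fun=> - m%:R) x * flat m.+1 (dot a x + b) + flat m.+2 (dot a x + b))).
    apply: SmoothM; first exact: SmoothCst.
    apply: SmoothD; last exact: SmoothFlat.
    by apply: SmoothM; [exact: SmoothCst|exact: SmoothFlat].
  by apply/funext => x; exact: (@is_derive_partial (fun y => flat m (dot a y + b)) x i _ (H x)).2.
- split=> [x|]; first exact: derivableD.
  rewrite (_ : partial _ _ = fun x => partial i f x + partial i g x).
    exact: SmoothD.
  by apply/funext => x; rewrite !partialE deriveD.
- split=> [x|]; first exact: derivableM.
  rewrite (_ : partial _ _ = fun x => f x * partial i g x + g x * partial i f x).
    by apply: SmoothD; exact: SmoothM.
  by apply/funext => x; rewrite !partialE deriveM.
Qed.

Lemma smooth_cst (c : R) : smooth (fun _ : vec => c).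
Proof. exact/smooth_expr_smooth/SmoothCst. Qed.

Lemma smooth_affine (a : vec) (b : R) : smooth (fun x => dot a x + b).
Proof. exact/smooth_expr_smooth/SmoothAffine. Qed.

Lemma smooth_flat m (a : vec) (b : R) : smooth (fun x => flat m (dot a x + b)).
Proof. exact/smooth_expr_smooth/SmoothFlat. Qed.

(** Given smooth functions enter [smooth_expr] as atoms, so that sums and products are handled
    without a Leibniz formula for iterated derivatives. *)
Lemma smoothD (f g : vec -> R) :
  smooth f -> smooth g -> smooth (fun x => f x + g x).
Proof. by move=> sf sg; apply/smooth_expr_smooth/SmoothD; exact: SmoothAtom. Qed.

Lemma smoothM (f g : vec -> R) :
  smooth f -> smooth g -> smooth (fun x => f x * g x).
Proof. by move=> sf sg; apply/smooth_expr_smooth/SmoothM; exact: SmoothAtom. Qed.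

Lemma smoothB (f g : vec -> R) :
  smooth f -> smooth g -> smooth (fun x => f x - g x).
Proof.
move=> sf sg; rewrite (_ : (fun _ => _) = fun x => f x + (fun=> -1) x * g x).
  exact: (smoothD sf (smoothM (smooth_cst _) sg)).
by apply/funext => x; rewrite mulN1r.
Qed.

Lemma partialB i (f g : vec -> R) x : smooth f -> smooth g ->
  partial i (fun x => f x - g x) x = partial i f x - partial i g x.
Proof. by move=> sf sg; rewrite !partialE deriveB//; exact: smooth_derivable. Qed.

Lemma partialM i (f g : vec -> R) x : smooth f -> smooth g ->
  partial i (fun x => f x * g x) x = f x * partial i g x + g x * partial i f x.
Proof. by move=> sf sg; rewrite !partialE deriveM//; exact: smooth_derivable. Qed.

Lemma partial_affine i (a : vec) (b : R) x :
  partial i (fun x => dot a x + b) x = a 0 i.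
Proof.
exact: (@is_derive_partial (fun y => dot a y + b) x i _
  (is_derive_affine_line a x b i)).2.
Qed.

Lemma upd_comm (x : vec) i j s t : i != j ->
  upd (upd x i s) j t = upd (upd x j t) i s.
Proof.
move=> ij; apply/rowP => k; rewrite !mxE.
by case: (eqVneq k j) => // ->; rewrite eq_sym (negPf ij).
Qed.

(* The second difference on the left is symmetric in i and j, whence Schwarz's
   theorem below. *)
Let square_MVT (f : vec -> R) (x : vec) i j (h : R) : smooth f -> i != j -> 0 < h ->
  exists2 p : vec, (forall k, `|x 0 k - p 0 k| <= h) &
    f (upd (upd x i (x 0 i + h)) j (x 0 j + h)) - f (upd x i (x 0 i + h))
      - f (upd x j (x 0 j + h)) + f x = partial j (partial i f) p * h ^+ 2.
Proof.
move=> sf ij h0.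
(* The mean value theorem is applied twice: in direction i to the j-increment [ph] of f, then in
   direction j to [ps], the i-th partial derivative at the intermediate point found. *)
pose ph s := f (upd (upd x j (x 0 j + h)) i s) - f (upd x i s).
pose dph s := partial i f (upd (upd x j (x 0 j + h)) i s)
              - partial i f (upd x i s).
have dphE (s : R) : is_derive s (1 : R) ph (dph s).
  by apply: is_deriveB; apply: is_derive_line; exact: smooth_derivable.
have cph : continuous ph.
  move=> s; apply: cvgB; apply: continuous_line; exact: smoothC.
have xi : x 0 i < x 0 i + h by rewrite ltrDl.
have xj : x 0 j < x 0 j + h by rewrite ltrDl.
have [s /[!in_itv]/= /andP[s1 s2] hs] :=
  MVT xi (fun s _ => dphE s) (continuous_subspaceT cph).
pose ps t := partial i f (upd (upd x i s) j t).
have dps (t : R) : is_derive t (1 : R) ps (partial j (partial i f) (upd (upd x i s) j t)).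
  by apply: is_derive_line; apply/smooth_derivable/smooth_partial.
have cps : continuous ps.
  by apply: continuous_line; apply/smoothC/smooth_partial.
have [t /[!in_itv]/= /andP[t1 t2] ht] :=
  MVT xj (fun s _ => dps s) (continuous_subspaceT cps).
exists (upd (upd x i s) j t).
  move=> k; rewrite !mxE; case: eqP => [->|_].
    by rewrite ler_distlC; apply/andP; split; lra.
  case: eqP => [->|_]; last by rewrite subrr normr0 ltW.
  by rewrite ler_distlC; apply/andP; split; lra.
rewrite addrAC addrC -addrA.
transitivity (ph (x 0 i + h) - ph (x 0 i)).
  rewrite /ph upd_self upd_comm// [upd (upd x j _) i (x 0 i)]upd_comm; last first.
    by rewrite eq_sym.
  by rewrite upd_self; ring.
rewrite hs [x 0 i + h]addrC addrK.
have -> : dph s = ps (x 0 j + h) - ps (x 0 j).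
  rewrite /dph /ps upd_comm ?[j == i]eq_sym//; congr (_ - partial i f _).
  by rewrite upd_comm// upd_self.
by rewrite ht [x 0 j + h]addrC addrK expr2 mulrA.
Qed.

(** The two functions need not agree at a common point: the intermediate points supplied by
    [square_MVT] for the two orders of differentiation are unrelated. If F and G differed by d at x,
    points p and p' where each varies by less than d/3 would give d <= 2d/3. *)
Let eq_continuous_near (F G : vec -> R) (x : vec) :
  continuous F -> continuous G ->
  (forall h : R, 0 < h -> exists p p' : vec,
    [/\ forall k, `|x 0 k - p 0 k| <= h, forall k, `|x 0 k - p' 0 k| <= h &
        F p = G p']) -> F x = G x.
Proof.
move=> cF cG near_eq.
apply/eqP; rewrite -subr_eq0; apply/negP => /negP; rewrite -normr_gt0 => d0.
set d : R := `| _ | in d0.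
have d3 : 0 < d / 3 by rewrite divr_gt0.
have /cvgrPdist_lt/(_ _ d3) /nbhs_ballP[e1 /= e10 h1] := cF x.
have /cvgrPdist_lt/(_ _ d3) /nbhs_ballP[e2 /= e20 h2] := cG x.
have [h h0 [h1e h2e]] : exists2 h : R, 0 < h & h < e1 /\ h < e2.
  have m0 : 0 < Num.min e1 e2 by rewrite lt_min e10.
  exists (Num.min e1 e2 / 2); first by rewrite divr_gt0.
  by apply/andP; rewrite -lt_min ltr_pdivrMr// mulr_natr mulr2n ltrDl.
have [p [p' [hp hp' FG]]] := near_eq h h0.
have b1 : ball x e1 p by apply/ball3P => // k; exact: le_lt_trans (hp k) _.
have b2 : ball x e2 p' by apply/ball3P => // k; exact: le_lt_trans (hp' k) _.
have := h1 _ b1; have := h2 _ b2; rewrite /= FG distrC => k2 k1.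
have : d <= d / 3 + d / 3.
  by apply: (le_trans (ler_distD (G p') _ _)); apply: lerD; exact: ltW.
by clear -d0; lra.
Qed.

Lemma partialC (f : vec -> R) i j (x : vec) : smooth f ->
  partial i (partial j f) x = partial j (partial i f) x.
Proof.
move=> sf; have [->//|ij] := eqVneq i j.
apply: eq_continuous_near => [||h h0].
- by apply/smoothC/smooth_partial/smooth_partial.
- by apply/smoothC/smooth_partial/smooth_partial.
have ji : j != i by rewrite eq_sym.
have [p hp Ep] := square_MVT x sf ij h0.
have [p' hp' Ep'] := square_MVT x sf ji h0.
exists p', p; split; [exact: hp'|exact: hp|].
apply: (mulIf (_ : h ^+ 2 != 0)); first by rewrite expf_neq0// gt_eqF.
rewrite -Ep' -Ep upd_comm; last exact: ji.
exact: (congr1 (+%R^~ _) (addrAC _ _ _)).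
Qed.

Lemma partial_support (A : set vec) (f : vec -> R) i : closed A ->
  (forall x, ~ A x -> f x = 0) -> forall x, ~ A x -> partial i f x = 0.
Proof.
move=> cA fA x Ax; rewrite partialE.
rewrite (@near_eq_derive _ _ _ f (cst 0)) ?derive_cst//.
have : nbhs x (~` A) by apply: open_nbhs_nbhs; split => //; exact: closed_openC.
by apply: filterS => y /= /fA ->.
Qed.

End Lines.

(** * Integrals over space, reduced to integrals along coordinate lines *)

Section Integration.
Variable R : realType.
Local Notation vec := 'rV[R]_3.
Local Notation mR := (measurableTypeR R).
Local Notation mu := (@lebesgue_measure R).
Local Notation X := (mR * mR * mR)%type.

(** Tonelli with the i-th variable innermost. Nonnegativity stands in for integrability, which lets
    the same lemma serve integration by parts, null hyperplanes and the Poincaré estimate. *)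
Lemma le_integral_lines (i : 'I_3) (F G : X -> \bar R) :
  measurable_fun setT F -> measurable_fun setT G ->
  (forall y, (0 <= F y)%E) -> (forall y, (0 <= G y)%E) ->
  (forall u : vec, (\int[mu]_s F (tp (upd u i s)) <=
                    \int[mu]_s G (tp (upd u i s)))%E) ->
  (\int[@leb3 R]_y F y <= \int[@leb3 R]_y G y)%E.
Proof.
move=> mF mG F0 G0.
have slice (H : X -> \bar R) : measurable_fun setT H -> forall z : mR,
    measurable_fun setT (fun x : mR * mR => H (x, z)).
  by move=> mH z; exact: measurableT_comp.
elim/ord3P: i => H.
- rewrite -[leLHS]/(\int[(@leb2 R \x mu)%E]_y F y)%E.
  rewrite -[leRHS]/(\int[(@leb2 R \x mu)%E]_y G y)%E.
  rewrite (fubini_tonelli2 F)// (fubini_tonelli2 G)//.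
  apply: ge0_le_integral => //.
  + by move=> z _; apply: integral_ge0.
  + exact: (measurable_fun_fubini_tonelli_G F).
  + exact: (measurable_fun_fubini_tonelli_G G).
  move=> z _; rewrite /fubini_G.
  rewrite -[leLHS]/(\int[(mu \x mu)%E]_x F (x, z))%E.
  rewrite -[leRHS]/(\int[(mu \x mu)%E]_x G (x, z))%E.
  rewrite (fubini_tonelli2 (fun x => F (x, z)))//; last exact: slice.
  rewrite (fubini_tonelli2 (fun x => G (x, z)))//; last exact: slice.
  apply: ge0_le_integral => //.
  + by move=> y _; apply: integral_ge0.
  + by apply: (measurable_fun_fubini_tonelli_G (fun x => F (x, z))) => //; exact: slice.
  + by apply: (measurable_fun_fubini_tonelli_G (fun x => G (x, z))) => //; exact: slice.
  move=> y _; rewrite /fubini_G; have := H (pt (0, y, z)).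
  have E (K : X -> \bar R) : (fun s => K (tp (upd (pt (0, y, z)) 0 s))) =
      (fun s => K (s, y, z)) by apply/funext => s; rewrite tp_upd0.
  by rewrite (E F) (E G).
- rewrite -[leLHS]/(\int[(@leb2 R \x mu)%E]_y F y)%E.
  rewrite -[leRHS]/(\int[(@leb2 R \x mu)%E]_y G y)%E.
  rewrite (fubini_tonelli2 F)// (fubini_tonelli2 G)//.
  apply: ge0_le_integral => //.
  + by move=> z _; apply: integral_ge0.
  + exact: (measurable_fun_fubini_tonelli_G F).
  + exact: (measurable_fun_fubini_tonelli_G G).
  move=> z _; rewrite /fubini_G.
  rewrite -[leLHS]/(\int[(mu \x mu)%E]_x F (x, z))%E.
  rewrite -[leRHS]/(\int[(mu \x mu)%E]_x G (x, z))%E.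
  rewrite (fubini_tonelli1 (fun x => F (x, z)))//; last exact: slice.
  rewrite (fubini_tonelli1 (fun x => G (x, z)))//; last exact: slice.
  apply: ge0_le_integral => //.
  + by move=> y _; apply: integral_ge0.
  + by apply: (measurable_fun_fubini_tonelli_F (fun x => F (x, z))) => //; exact: slice.
  + by apply: (measurable_fun_fubini_tonelli_F (fun x => G (x, z))) => //; exact: slice.
  move=> x _; rewrite /fubini_F; have := H (pt (x, 0, z)).
  have E (K : X -> \bar R) : (fun s => K (tp (upd (pt (x, 0, z)) 1 s))) =
      (fun s => K (x, s, z)) by apply/funext => s; rewrite tp_upd1.
  by rewrite (E F) (E G).
- rewrite -[leLHS]/(\int[(@leb2 R \x mu)%E]_y F y)%E.
  rewrite -[leRHS]/(\int[(@leb2 R \x mu)%E]_y G y)%E.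
  rewrite (fubini_tonelli1 F)// (fubini_tonelli1 G)//.
  apply: ge0_le_integral => //.
  + by move=> z _; apply: integral_ge0.
  + exact: (measurable_fun_fubini_tonelli_F F).
  + exact: (measurable_fun_fubini_tonelli_F G).
  move=> x _; rewrite /fubini_F; have := H (pt (x, 0)).
  have E (K : X -> \bar R) : (fun s => K (tp (upd (pt (x, 0)) 2%:R s))) =
      (fun s => K (x, s)).
    by apply/funext => s; case: x => a b; rewrite tp_upd2.
  by rewrite (E F) (E G).
Qed.

(** This says that the integral of g' is 0, by the fundamental theorem on an interval at whose ends
    g vanishes. It is split into positive and negative parts because [le_integral_lines] accepts
    only nonnegative functions. *)
Lemma integral_derive_posneg (g g' : R -> R) (M : R) :
  (forall s : R, is_derive s (1 : R) g (g' s)) -> continuous g' ->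
  (forall s, M <= `|s| -> g s = 0) -> (forall s, M <= `|s| -> g' s = 0) ->
  (\int[mu]_s (EFin \o g')^\+ s = \int[mu]_s (EFin \o g')^\- s)%E.
Proof.
move=> dg cg' g0 g'0.
(* The maximum with 1 keeps the interval from -K to K nondegenerate for every M. *)
pose K : R := Num.max M 1.
have K0 : 0 < K by rewrite lt_max ltr01 orbT.
have KM (s : R) : K <= `|s| -> M <= `|s| by apply: le_trans; rewrite le_max lexx.
have KK : - K < K by rewrite gtrN.
pose D : set R := `[- K, K]%classic.
have mD : measurable (D : set mR) by exact: measurable_itv.
have restr : EFin \o g' = (EFin \o g') \_ D.
  apply/funext => s; rewrite /patch; case: ifPn => // /negP; rewrite inE /D /=.
  rewrite in_itv/= => /negP; rewrite -ler_norml -ltNge => /ltW/KM/g'0 E.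
  by rewrite E.
have cin : {within D, continuous g'} by exact: continuous_subspaceT.
have cg : continuous g.
  move=> s; apply: differentiable_continuous; apply/derivable1_diffP.
  by case: (dg s).
have I0 : (\int[mu]_(s in D) (EFin \o g') s = 0)%E.
  rewrite (@continuous_FTC2 _ g' g)//.
  - rewrite !g0 ?subee//; apply: KM; rewrite ?normrN ger0_norm// ltW//.
  - split.
    + by move=> s _; case: (dg s).
    + by apply: cvg_at_right_filter; exact: cg.
    + by apply: cvg_at_left_filter; exact: cg.
  - by move=> s _; rewrite derive1E; case: (dg s).
have int : mu.-integrable D (EFin \o g').
  by apply: continuous_compact_integrable => //; exact: segment_compact.
have ip := integrable_pos_fin_num mD int.
have iN := integrable_neg_fin_num mD int.
rewrite restr funepos_restrict funeneg_restrict -!integral_mkcond.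
have := integralE mu D (EFin \o g'); rewrite I0 => /esym/eqP.
by rewrite sube_eq ?add0e//; move/eqP.
Qed.

Let measurable_patch (D : set X) (f : X -> \bar R) :
  measurable D -> measurable_fun setT f -> measurable_fun setT (f \_ D).
Proof.
move=> mD mf; apply/(measurable_restrictT f mD).
exact: (measurable_funTS mf).
Qed.

Let measurable_line (w : vec) (i : 'I_3) :
  measurable_fun setT (fun s : mR => tp (upd w i s) : X).
Proof.
have m j : measurable_fun setT (fun s : mR => upd w i s 0 j : mR).
  rewrite (_ : (fun _ => _) = fun s => if j == i then s else w 0 j); last first.
    by apply/funext => s; rewrite mxE.
  by case: eqP.
apply: measurable_fun_pair; last exact: m.
by apply: measurable_fun_pair; exact: m.
Qed.

Let line_derive (f : vec -> R) (i : 'I_3) (u : vec) : smooth f ->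
  forall s : R, is_derive s (1 : R) (fun t => f (upd u i t))
                  (partial i f (upd u i s)).
Proof. by move=> sf s; apply: is_derive_line; exact: smooth_derivable. Qed.

Let measurable_smooth (f : vec -> R) : smooth f ->
  measurable_fun setT (fun y : X => f (pt y)).
Proof. by move=> sf; exact: (pt_measurable_fun (smoothC sf)). Qed.

(** On each line in direction i the positive and negative parts of the derivative have equal
    integrals; two uses of [le_integral_lines] transfer the equality to space. *)
Lemma Rintegral_partial (f : vec -> R) (i : 'I_3) (A : set vec) :
  smooth f -> compact A -> (forall x, ~ A x -> f x = 0) ->
  \int[@leb3 R]_y partial i f (pt y) = 0.
Proof.
move=> sf cA fA.
have clA : closed A by apply: compact_closed => //; exact: norm_hausdorff.
have dA := @partial_support _ A f i clA fA.
have [M HM] : exists M : R, forall x, A x -> `|x| <= M.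
  have [M [_ HM]] := compact_bounded cA.
  by exists (M + 1) => x Ax; apply: (HM (M + 1)); rewrite ?ltrDl.
have out (u : vec) (s : R) : M + 1 <= `|s| -> ~ A (upd u i s).
  move=> Ms /HM; rewrite leNgt; apply/negP/negPn.
  apply: (@lt_le_trans _ _ `|s|); first by apply: lt_le_trans Ms; rewrite ltrDl.
  by rewrite -[s in leLHS](updE u i s); exact: ler_mx_coord.
set g := (EFin \o (partial i f \o @pt R) : X -> \bar R).
have mg : measurable_fun setT g.
  apply/measurable_EFinP; exact: (measurable_smooth (smooth_partial i sf)).
have eq_pn (u : vec) : (\int[mu]_s (g^\+ (tp (upd u i s))) =
    \int[mu]_s (g^\- (tp (upd u i s))))%E.
  pose g' (s : R) := partial i f (upd u i s).
  have gE : (fun s : R => g (tp (upd u i s))) = EFin \o g'.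
    by apply/funext => s; rewrite /g /= tpK.
  have h : (\int[mu]_s (EFin \o g')^\+ s = \int[mu]_s (EFin \o g')^\- s)%E.
    apply: (@integral_derive_posneg (fun s => f (upd u i s)) g' (M + 1)).
    - exact: line_derive.
    - exact: (continuous_line (smoothC (smooth_partial i sf))).
    - by move=> s Ms; apply: fA; exact: out.
    - by move=> s Ms; apply: dA; exact: out.
  have E1 : (fun s : R => (g^\+ (tp (upd u i s)))%E) = (EFin \o g')^\+%E.
    by apply/funext => s; rewrite !funeposE /g /= tpK.
  have E2 : (fun s : R => (g^\- (tp (upd u i s)))%E) = (EFin \o g')^\-%E.
    by apply/funext => s; rewrite !funenegE /g /= tpK.
  by rewrite [in LHS]E1 [in RHS]E2.
have H : (\int[@leb3 R]_y g^\+ y = \int[@leb3 R]_y g^\- y)%E.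
  apply/eqP; rewrite eq_le; apply/andP; split; apply: (@le_integral_lines i).
  - exact: measurable_funepos.
  - exact: measurable_funeneg.
  - by move=> y; exact: funepos_ge0.
  - by move=> y; exact: funeneg_ge0.
  - by move=> u; rewrite eq_pn.
  - exact: measurable_funeneg.
  - exact: measurable_funepos.
  - by move=> y; exact: funeneg_ge0.
  - by move=> y; exact: funepos_ge0.
  - by move=> u; rewrite eq_pn.
rewrite /Rintegral -[X in fine X]/(\int[@leb3 R]_y g y)%E integralE H.
(* An infinite common value gives 0 as well, because [fine] sends infinite values to 0. *)
by case: (\int[@leb3 R]_y g^\- y)%E => [r||] //=; rewrite subrr.
Qed.

(** A line in a direction i with [a 0 i != 0] meets the hyperplane in the single point [s0], so the
    indicator integrates to 0 along every such line. *)
Lemma null_hyperplane (a : vec) (b : R) : a != 0 ->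
  leb3 ((@pt R : X -> vec) @^-1` [set x | dot a x + b = 0]) = 0%E.
Proof.
move=> a0.
have [i ai] : exists i, a 0 i != 0.
  apply/existsP; rewrite -negb_forall; apply: contra a0 => /forallP h.
  by apply/eqP/rowP => i; rewrite mxE; exact/eqP.
set P : set X := _ @^-1` _.
have mP : measurable P.
  apply: pt_measurable_closed; rewrite (_ : mkset _ =
    (fun x => dot a x + b) @^-1` [set 0]) //.
  by apply: closed_comp; [move=> x _; exact: affine_continuous|exact: closed_eq].
apply/eqP; rewrite eq_le measure_ge0 andbT.
rewrite -[P]setIT -integral_indic// -(integral0 (@leb3 R) setT).
apply: (@le_integral_lines i) => //.
- exact/measurable_EFinP/measurable_indic.
move=> u; rewrite integral0.
pose s0 := u 0 i - (dot a u + b) / a 0 i.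
rewrite (_ : (fun s => _) = EFin \o \1_[set s0]).
  by rewrite integral_indic//= setIT lebesgue_measure_set1.
apply/funext => s /=; rewrite !indicE; congr (nat_of_bool _)%:R%:E.
have E : dot a (upd u i s) + b = dot a u + b + (s - u 0 i) * a 0 i.
  by rewrite -[s in LHS](subrK (u 0 i)) upd_shift upd_self dotDr dotZr dot_delta; ring.
apply/idP/idP; rewrite !inE /P /= tpK E /s0 => h.
  apply: (mulIf ai); rewrite mulrBl divfK//.
  by apply/eqP; rewrite -subr_eq0; apply/eqP; rewrite -[RHS]h; ring.
by rewrite h [u 0 i - _ - _]addrAC subrr add0r mulNr divfK// subrr.
Qed.

Let le_integral_derive (g g' : R -> R) (c r : R) (s t : R) :
  (forall s : R, is_derive s (1 : R) g (g' s)) -> continuous g' ->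
  `|c - s| < r -> `|c - t| < r ->
  (`|g s - g t|%:E <= \int[mu]_(z in ball c r) `|g' z|%:E)%E.
Proof.
move=> dg cg'; wlog st : s t / s <= t.
  move=> H hs ht; have [|/ltW] := leP s t; first by move=> /H; exact.
  by move=> /H h; rewrite distrC; exact: h.
move=> hs ht; move: st; rewrite le_eqVlt => /predU1P[->|st].
  by rewrite subrr normr0; apply: integral_ge0 => z _; rewrite lee_fin.
have mg' : measurable_fun setT (g' : mR -> mR) by exact: continuous_measurable_fun.
have cg : continuous g.
  move=> z; apply: differentiable_continuous; apply/derivable1_diffP.
  by case: (dg z).
have mb : measurable (ball c r : set mR).
  by rewrite ball_itv; exact: measurable_itv.
have sub : [set` `[s, t]] `<=` ball c r.
  move=> z /=; rewrite in_itv/= => /andP[z1 z2]; move: hs ht.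
  rewrite /ball/= !ltr_distlC => /andP[h1 h2] /andP[h3 h4].
  by apply/andP; split; lra.
have E : (\int[mu]_(z in `[s, t]) (g' z)%:E = (g t)%:E - (g s)%:E)%E.
  apply: continuous_FTC2 => //.
  - exact: continuous_subspaceT.
  - split.
    + by move=> z _; case: (dg z).
    + by apply: cvg_at_right_filter; exact: cg.
    + by apply: cvg_at_left_filter; exact: cg.
  - by move=> z _; rewrite derive1E; case: (dg z).
rewrite distrC -abse_EFin EFinB -E.
apply: (@le_trans _ _ (\int[mu]_(z in `[s, t]) `|(g' z)%:E|)%E).
  apply: le_abse_integral => //; apply/measurable_EFinP.
  exact: measurable_funTS mg'.
apply: ge0_subset_integral => //.
apply: measurableT_comp => //; apply/measurable_EFinP.
exact: measurable_funTS mg'.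
Qed.

(* On each line in direction i, f vanishes at a point of the longer box, so that
   |f| is bounded by the integral of |partial i f| along the line. *)
Lemma le_integral_box (f : vec -> R) (i : 'I_3) (u : vec) (t c r d : R) :
  smooth f -> 0 < d -> `|c - t| < r -> (forall s, `|u 0 i - s| < d -> `|c - s| < r) ->
  box (upd u i t) (fun=> d) `<=` [set x | f x = 0] ->
  (\int[@leb3 R]_(y in @pt R @^-1` box u (fun=> d)) `|f (pt y)|%:E <=
   \int[@leb3 R]_(y in @pt R @^-1`
      box (upd u i c) (fun j => if j == i then r else d))
     (d *+ 2 * `|partial i f (pt y)|)%:E)%E.
Proof.
move=> sf d0 ct us f0.
have mB := measurable_pt_box u (fun=> d).
have mL := measurable_pt_box (upd u i c) (fun j => if j == i then r else d).
have mf : measurable_fun setT (fun y : X => `|f (pt y)|%:E).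
  apply/measurable_EFinP/measurableT_comp => //.
  exact: (measurable_smooth sf).
have mdf : measurable_fun setT (fun y : X => (d *+ 2 * `|partial i f (pt y)|)%:E).
  apply/measurable_EFinP/measurable_funM => //; apply/measurableT_comp => //.
  exact: (measurable_smooth (smooth_partial i sf)).
rewrite integral_mkcond [leRHS]integral_mkcond.
apply: (@le_integral_lines i).
- exact: measurable_patch.
- exact: measurable_patch.
- by move=> y; apply: erestrict_ge0 => ? _; rewrite lee_fin.
- move=> y; apply: erestrict_ge0 => ? _; rewrite lee_fin.
  by rewrite mulr_ge0// mulrn_wge0// ltW.
move=> w.
(* A line that misses the small box contributes 0 to the left-hand side. *)
have [near|far] := pselect (forall j, j != i -> `|u 0 j - w 0 j| < d); last first.
  apply: (@le_trans _ _ 0%E).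
    rewrite integral0_eq// => s _; rewrite /patch; case: ifPn => //.
    rewrite inE /= tpK => H; exfalso; apply: far => j ji.
    by have := H j; rewrite mxE (negPf ji).
  apply: integral_ge0 => s _; apply: erestrict_ge0 => ? _; rewrite lee_fin.
  by rewrite mulr_ge0// mulrn_wge0// ltW.
pose g' s := partial i f (upd w i s).
have cg' : continuous g' by exact: (continuous_line (smoothC (smooth_partial i sf))).
have mg' : measurable_fun setT (g' : mR -> mR) by exact: continuous_measurable_fun.
have mb (z e : R) : measurable (ball z e : set mR).
  by rewrite ball_itv; exact: measurable_itv.
pose K : \bar R := (\int[mu]_(z in ball c r) `|g' z|%:E)%E.
have bound s : `|u 0 i - s| < d -> (`|f (upd w i s)|%:E <= K)%E.
  move=> /us cs.
  have ft : f (upd w i t) = 0.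
    apply: f0 => j; rewrite !mxE; case: eqP => [_|/eqP ji]; last exact: near.
    by rewrite subrr normr0.
  have := @le_integral_derive (fun s => f (upd w i s)) g' c r s t
    (line_derive i w sf) cg' cs ct.
  by rewrite ft subr0.
(* The line meets the box in an interval of length [d *+ 2], on which the constant K majorises
   |f|. *)
apply: (@le_trans _ _ (K * (d *+ 2)%:E)%E).
  rewrite -(@lebesgue_measure_ball R (u 0 i) d (ltW d0)) -integral_cst//.
  rewrite [X in (_ <= X)%E]integral_mkcond; apply: ge0_le_integral => //.
  - by move=> s _; apply: erestrict_ge0 => ? _; rewrite lee_fin.
  - apply: (measurableT_comp (f := (fun y : X => `|f (pt y)|%:E) \_ _)).
      exact: measurable_patch.
    exact: measurable_line.
  - by apply/(measurable_restrictT _ _).1.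
  move=> s _; rewrite /patch; case: ifPn => [|_].
    rewrite inE /= tpK => H.
    have us' : `|u 0 i - s| < d by have := H i; rewrite updE.
    by rewrite ifT ?inE//; exact: bound.
  case: ifPn => // _; apply: integral_ge0 => // z _; by rewrite lee_fin.
rewrite muleC -ge0_integralZl//; last 2 first.
- apply/measurable_EFinP/measurableT_comp => //; exact: measurable_funTS mg'.
- by rewrite lee_fin mulrn_wge0// ltW.
rewrite integral_mkcond le_eqVlt; apply/orP; left; apply/eqP.
apply: eq_integral => s _; rewrite /patch.
have -> : (tp (upd w i s) \in ((@pt R : X -> vec) @^-1` box (upd u i c)
    (fun j => if j == i then r else d))) = (s \in (ball c r : set R)).
  apply/idP/idP; rewrite !inE /= tpK => H.
    by have := H i; rewrite !mxE !eqxx.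
  by move=> j; rewrite !mxE; case: eqP => // /eqP; exact: near.
by case: ifP => // _; rewrite tpK.
Qed.

End Integration.

(** * The L^2 product on [Om], and orthogonality to test functions *)

Section L2Algebra.
Variables (R : realType) (Om : set 'rV[R]_3).
Hypothesis oOm : open Om.
Local Notation vec := 'rV[R]_3.
Local Notation mR := (measurableTypeR R).
Local Notation X := (mR * mR * mR)%type.
Local Notation D := ((@pt R : X -> vec) @^-1` Om).

Let mD : measurable D. Proof. exact: pt_measurable. Qed.

Lemma L2_measurable (f : vec -> R) :
  L2 Om f -> measurable_fun D (fun y : X => f (pt y)).
Proof.
rewrite /L2 inE => /andP[+ _]; rewrite inE /= => mf.
by apply/(measurable_restrictT (fun y : X => f (pt y)) mD).
Qed.

Lemma L2M_integrable (f g : vec -> R) : L2 Om f -> L2 Om g ->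
  (@leb3 R).-integrable D (EFin \o (fun y : X => f (pt y) * g (pt y))).
Proof.
move=> lf lg; apply/(integrable_mkcond _ mD).
have := Lfun2_mul_Lfun1 lf lg => /Lfun1_integrable.
rewrite restrict_EFin; congr integrable; congr (EFin \o _).
by apply/funext => y; rewrite /= /patch; case: ifP => //; rewrite mulr0.
Qed.

Lemma eq_L2 (f g : vec -> R) : (forall x, Om x -> f x = g x) ->
  L2 Om f -> L2 Om g.
Proof.
move=> fg; rewrite /L2 (_ : (f \o _) \_ _ = (g \o @pt R) \_ (@pt R @^-1` Om))//.
by apply/funext => y; rewrite /patch; case: ifPn => //; rewrite inE /= => /fg.
Qed.

Lemma L2_lin (a : R) (f g : vec -> R) : L2 Om f -> L2 Om g ->
  L2 Om (fun x => a * f x + g x).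
Proof.
move=> lf lg; rewrite /L2.
rewrite (_ : _ \_ _ = (a \o* ((f \o @pt R) \_ D)) + ((g \o @pt R) \_ D)).
  apply: rpredD => //; first by rewrite lee_fin ler1n.
  by move=> ?; apply: Lfun_scale => //; rewrite ler1n.
apply/funext => y; rewrite /= /patch /GRing.add/=; case: ifPn => _.
  by rewrite [X in X + _]mulrC.
by rewrite mul0r addr0.
Qed.

Lemma L2Z (a : R) (f : vec -> R) : L2 Om f -> L2 Om (fun x => a * f x).
Proof.
move=> lf; apply: (@eq_L2 (fun x => (a - 1) * f x + f x)); last exact: L2_lin.
by move=> x _; ring.
Qed.

Lemma L2D (f g : vec -> R) : L2 Om f -> L2 Om g -> L2 Om (fun x => f x + g x).
Proof.
move=> lf lg; apply: (@eq_L2 (fun x => 1 * f x + g x)); last exact: L2_lin.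
by move=> x _; rewrite mul1r.
Qed.

Lemma L2B (f g : vec -> R) : L2 Om f -> L2 Om g -> L2 Om (fun x => f x - g x).
Proof.
move=> lf lg; apply: (@eq_L2 (fun x => -1 * g x + f x)); last exact: L2_lin.
by move=> x _; rewrite mulN1r addrC.
Qed.

Lemma ipC (f g : vec -> R) : ip Om f g = ip Om g f.
Proof. by apply: eq_Rintegral => y _; rewrite mulrC. Qed.

Lemma eq_ip (f f' g g' : vec -> R) : (forall x, Om x -> f x = f' x) ->
  (forall x, Om x -> g x = g' x) -> ip Om f g = ip Om f' g'.
Proof.
by move=> ff gg; apply: eq_Rintegral => y; rewrite inE /= => Dy; rewrite ff// gg.
Qed.

Lemma ipDr (f g h : vec -> R) : L2 Om f -> L2 Om g -> L2 Om h ->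
  ip Om f (fun x => g x + h x) = ip Om f g + ip Om f h.
Proof.
move=> lf lg lh; rewrite /ip -RintegralD//; try exact: L2M_integrable.
by apply: eq_Rintegral => y _; rewrite mulrDr.
Qed.

Lemma ipZr (a : R) (f g : vec -> R) : L2 Om f -> L2 Om g ->
  ip Om f (fun x => a * g x) = a * ip Om f g.
Proof.
move=> lf lg; rewrite /ip -RintegralZl//; try exact: L2M_integrable.
by apply: eq_Rintegral => y _; rewrite mulrCA.
Qed.

Lemma ipBr (f g h : vec -> R) : L2 Om f -> L2 Om g -> L2 Om h ->
  ip Om f (fun x => g x - h x) = ip Om f g - ip Om f h.
Proof.
move=> lf lg lh; rewrite -[- ip _ _ _]mulN1r -ipZr// -ipDr//; last exact: L2Z.
by apply: eq_ip => // x _; rewrite mulN1r.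
Qed.

Lemma ipDl (f g h : vec -> R) : L2 Om f -> L2 Om g -> L2 Om h ->
  ip Om (fun x => g x + h x) f = ip Om g f + ip Om h f.
Proof. by move=> *; rewrite ipC ipDr// ![ip _ f _]ipC. Qed.

Lemma ipBl (f g h : vec -> R) : L2 Om f -> L2 Om g -> L2 Om h ->
  ip Om (fun x => g x - h x) f = ip Om g f - ip Om h f.
Proof. by move=> *; rewrite ipC ipBr// ![ip _ f _]ipC. Qed.

Lemma ipZl (a : R) (f g : vec -> R) : L2 Om f -> L2 Om g ->
  ip Om (fun x => a * g x) f = a * ip Om g f.
Proof. by move=> *; rewrite ipC ipZr// ![ip _ f _]ipC. Qed.

Lemma ip_ge0 (f : vec -> R) : 0 <= ip Om f f.
Proof. by apply: Rintegral_ge0 => y _; rewrite -expr2 sqr_ge0. Qed.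

Lemma ip_CauchySchwarz (f g : vec -> R) : L2 Om f -> L2 Om g ->
  ip Om f g ^+ 2 <= ip Om f f * ip Om g g.
Proof.
move=> lf lg.
set a := ip Om f f; set b := ip Om f g; set c := ip Om g g.
have quad (t : R) : 0 <= a - t * b - t * b + t * t * c.
  have := ip_ge0 (fun x => f x - t * g x).
  have lt := L2Z t lg; have lft := L2B lf lt.
  rewrite ipBr// !ipBl// !ipZr// !ipZl// [ip Om g f]ipC -/a -/b -/c.
  by congr (0 <= _); ring.
have [c0|c0] := eqVneq c 0.
  rewrite c0 mulr0; have [->|b0] := eqVneq b 0; first by rewrite expr0n.
  (* For c = 0 the quadratic is affine in t; this t gives it the value -1. *)
  have := quad ((a + 1) / (b * 2)).
  have -> : a - (a + 1) / (b * 2) * b - (a + 1) / (b * 2) * b +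
      (a + 1) / (b * 2) * ((a + 1) / (b * 2)) * c = - 1.
    by rewrite c0; field.
  by rewrite oppr_ge0 ler10.
have c1 : 0 < c by rewrite lt_def c0 ip_ge0.
have := quad (b / c).
have -> : a - b / c * b - b / c * b + b / c * (b / c) * c = (a * c - b ^+ 2) / c.
  by field.
by rewrite pmulr_lge0 ?invr_gt0// subr_ge0.
Qed.

Lemma ip_null (f g : vec -> R) : L2 Om f -> L2 Om g -> ip Om f f = 0 ->
  ip Om f g = 0.
Proof.
move=> lf lg f0; have := ip_CauchySchwarz lf lg; rewrite f0 mul0r => h.
by apply/eqP; rewrite -sqrf_eq0 eq_le h sqr_ge0.
Qed.

Lemma ip_shift (f g : vec -> R) : L2 Om f -> L2 Om g -> ip Om f f = 0 ->
  ip Om (fun x => f x - g x) (fun x => f x - g x) = ip Om g g.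
Proof.
move=> lf lg f0; have lfg := L2B lf lg.
rewrite ipBr// !ipBl// [ip Om g f]ipC (ip_null lf lg f0) f0.
by rewrite !sub0r oppr0 sub0r opprK.
Qed.

Lemma ip_cvg0 (f : nat -> vec -> R) (g : vec -> R) :
  (forall n, L2 Om (f n)) -> L2 Om g ->
  ip Om (f n) (f n) @[n --> \oo] --> 0 -> ip Om (f n) g @[n --> \oo] --> 0.
Proof.
move=> lf lg /cvgrPdist_lt f0; apply/cvgrPdist_lt => e e0.
have c0 : 0 < ip Om g g + 1 by rewrite ltr_wpDl// ip_ge0.
have := f0 (e ^+ 2 / (ip Om g g + 1)) (divr_gt0 (exprn_gt0 2 e0) c0).
apply: filterS => n; rewrite !sub0r !normrN => h.
rewrite -(@ltr_pXn2r _ 2%N) ?nnegrE// ?ltW// real_normK ?num_real//.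
apply: (le_lt_trans (ip_CauchySchwarz (lf n) lg)).
rewrite ger0_norm ?ip_ge0// ltr_pdivlMr// in h; apply: le_lt_trans h.
by rewrite ler_wpM2l ?ip_ge0// lerDl ler01.
Qed.

Lemma ipv_sum (F G : vec -> vec) : L2v Om F -> L2v Om G ->
  ipv Om F G = \sum_i ip Om (coordf F i) (coordf G i).
Proof.
move=> lF lG; have I i := L2M_integrable (lF i) (lG i).
have I01 := integrableD mD (I 0) (I 1).
rewrite sum3 /ip -RintegralD// -RintegralD//.
by apply: eq_Rintegral => y _; rewrite /dot sum3.
Qed.

Lemma L2_bounded (f : vec -> R) (M : R) : bounded_set Om ->
  measurable_fun D (fun y : X => f (pt y)) ->
  (forall x, Om x -> `|f x| <= M) -> L2 Om f.
Proof.
move=> bOm mf fM.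
have [K K0 OmK] : exists2 K : R, 0 < K & Om `<=` box 0 (fun=> K).
  have [K [_ hK]] := bOm.
  exists (`|K| + 2); first by rewrite ltr_wpDl.
  move=> x Omx j; rewrite !mxE sub0r normrN.
  apply: (le_lt_trans (ler_mx_coord x j)).
  apply: (@le_lt_trans _ _ (`|K| + 1)); last by rewrite ltrD2l ltr1n.
  by apply: hK => //; rewrite (le_lt_trans (ler_norm K))// ltrDl.
rewrite /L2 inE; apply/andP; split; rewrite inE /=.
  exact/(measurable_restrictT (fun y : X => f (pt y)) mD).
rewrite /finite_norm unlock; apply: poweR_lty.
pose M' : R := `|M|.
apply: (@le_lt_trans _ _ (\int[@leb3 R]_(y in (@pt R : X -> vec) @^-1` box 0 (fun=> K)) (M' ^+ 2)%:E)%E).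
  rewrite [leRHS]integral_mkcond; apply: ge0_le_integral => //.
  - by move=> y _; exact: poweR_ge0.
  - apply: (@measurableT_comp _ _ _ _ _ _ (fun x : \bar R => (x `^ 2)%E)).
      exact: measurable_poweR.
    apply: measurableT_comp => //; apply/measurable_EFinP.
    exact/(measurable_restrictT (fun y : X => f (pt y)) mD).
  - apply/(measurable_restrictT _ _).1 => //; exact: measurable_pt_box.
  move=> y _; rewrite /= /patch; case: ifPn => [|_]; last first.
    rewrite normr0 powR0//; by case: ifP => // _; rewrite lee_fin sqr_ge0.
  rewrite inE => Dy; rewrite ifT ?inE; last exact: OmK.
  rewrite lee_fin powR_mulrn// lerXn2r ?nnegrE//.
    by rewrite /M'.
  by rewrite /M' /= (le_trans (fM _ Dy))// ler_norm.
rewrite integral_cst; last exact: measurable_pt_box.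
by rewrite [X in (_ * X)%E]leb3_box// -EFinM ltry.
Qed.

Lemma smooth_bounded (g : vec -> R) : bounded_set Om -> smooth g ->
  exists M, forall x, Om x -> `|g x| <= M.
Proof.
move=> [K [_ hK]] sg.
pose A : set vec := [set x | `|x| <= K + 1].
have cA : compact A.
  apply: bounded_closed_compact.
    exists (K + 1); split; [exact: num_real|move=> M /ltW KM x /= xA].
    exact: le_trans KM.
  rewrite (_ : A = (fun x : vec => `|x|) @^-1` [set t | t <= K + 1])//.
  by apply: closed_comp; [move=> x _; exact: norm_continuous|exact: closed_le].
have cgA : compact (g @` A).
  apply: continuous_compact cA; apply: continuous_subspaceT; exact: smoothC.
have [M [_ hM]] := compact_bounded cgA.
exists (M + 1) => x Omx; apply: (hM (M + 1)); first by rewrite ltrDl.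
by exists x => //; apply: hK => //; rewrite ltrDl.
Qed.

Lemma smooth_L2 (g : vec -> R) : bounded_set Om -> smooth g -> L2 Om g.
Proof.
move=> bOm sg; have [M gM] := smooth_bounded bOm sg.
apply: L2_bounded gM => //.
exact: measurable_funTS (pt_measurable_fun (smoothC sg)).
Qed.

Lemma cst_L2 (c : R) : bounded_set Om -> L2 Om (fun=> c).
Proof. by move=> bOm; apply: smooth_L2 => //; exact: smooth_cst. Qed.

(** Pointwise [|z| <= e + e^-1 * z ^ 2], by comparing |z| with e. The free parameter e turns
    smallness in L^2 into smallness of the integral of |f| over a set of finite measure. *)
Lemma L1_le (f : vec -> R) (S : set vec) (e : R) : L2 Om f -> S `<=` Om ->
  measurable ((@pt R : X -> vec) @^-1` S) -> 0 < e ->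
  (\int[@leb3 R]_(y in @pt R @^-1` S) `|f (pt y)|%:E <=
   e%:E * leb3 ((@pt R : X -> vec) @^-1` S) + (e^-1 * ip Om f f)%:E)%E.
Proof.
move=> lf SOm mS e0.
have I := L2M_integrable lf lf.
have SD : (@pt R : X -> vec) @^-1` S `<=` D by move=> y /SOm.
have mf := measurable_funS mD SD (L2_measurable lf).
have ipE : ((ip Om f f)%:E = \int[@leb3 R]_(y in D) (f (pt y) * f (pt y))%:E)%E.
  by rewrite /ip /Rintegral fineK//; exact: integrable_fin_num.
have mff : measurable_fun ((@pt R : X -> vec) @^-1` S)
    (fun y : X => (e^-1 * (f (pt y) * f (pt y)))%:E).
  by apply/measurable_EFinP/measurable_funM => //; exact: measurable_funM.
apply: (@le_trans _ _ (\int[@leb3 R]_(y in @pt R @^-1` S)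
    (e%:E + (e^-1 * (f (pt y) * f (pt y)))%:E))%E).
  apply: ge0_le_integral => //.
  - by apply/measurable_EFinP/measurableT_comp.
  - by apply: emeasurable_funD.
  move=> y _; rewrite -EFinD lee_fin; set z := f (pt y).
  rewrite -expr2 -real_normK ?num_real//.
  have [ze|/ltW ze] := leP `|z| e.
    by rewrite (le_trans ze)// lerDl mulr_ge0// ?sqr_ge0// invr_ge0 ltW.
  rewrite ler_wpDl ?(ltW e0)// mulrC ler_pdivlMr// expr2.
  by rewrite ler_wpM2l.
rewrite ge0_integralD//; last 2 first.
- by move=> y _; rewrite lee_fin ltW.
- by move=> y _; rewrite lee_fin mulr_ge0 ?invr_ge0 ?(ltW e0)// -expr2 sqr_ge0.
rewrite integral_cst// leeD2l// EFinM ipE.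
under eq_integral do rewrite EFinM.
have e1 : (0 <= (e^-1)%:E :> \bar R)%E by rewrite lee_fin invr_ge0 ltW.
rewrite ge0_integralZl//.
- apply: lee_wpmul2l => //; apply: ge0_subset_integral => //.
  + exact: (measurable_int _ I).
  + by move=> y _; rewrite lee_fin -expr2 sqr_ge0.
- by apply/measurable_EFinP; exact: measurable_funM.
- by move=> y _; rewrite lee_fin -expr2 sqr_ge0.
Qed.

Lemma integral_norm_le (f g : vec -> R) (S : set vec) (M e : R) :
  L2 Om f -> L2 Om g -> S `<=` Om ->
  measurable ((@pt R : X -> vec) @^-1` S) -> 0 <= M -> 0 < e ->
  (forall x, S x -> `|f x| <= M + `|g x|) ->
  (\int[@leb3 R]_(y in @pt R @^-1` S) `|f (pt y)|%:E <=
   (M + e)%:E * leb3 ((@pt R : X -> vec) @^-1` S) + (e^-1 * ip Om g g)%:E)%E.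
Proof.
move=> lf lg SOm mS M0 e0 fMg.
have SD : (@pt R : X -> vec) @^-1` S `<=` D by move=> y /SOm.
have mf := measurable_funS mD SD (L2_measurable lf).
have mg := measurable_funS mD SD (L2_measurable lg).
apply: (@le_trans _ _ (\int[@leb3 R]_(y in @pt R @^-1` S)
    (M%:E + `|g (pt y)|%:E))%E).
  apply: ge0_le_integral => //.
  - by apply/measurable_EFinP/measurableT_comp.
  - by apply: emeasurable_funD => //; apply/measurable_EFinP/measurableT_comp.
  by move=> y Sy; rewrite -EFinD lee_fin; exact: fMg.
rewrite ge0_integralD//; last by apply/measurable_EFinP/measurableT_comp.
rewrite integral_cst//.
have -> : ((M + e)%:E * leb3 ((@pt R : X -> vec) @^-1` S) =
    M%:E * leb3 ((@pt R : X -> vec) @^-1` S)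
    + e%:E * leb3 ((@pt R : X -> vec) @^-1` S))%E.
  by rewrite EFinD ge0_muleDl// lee_fin ltW.
rewrite -[X in (_ <= X)%E]addeA; apply: leeD2l; exact: (L1_le lg SOm mS e0).
Qed.

Lemma smooth_prod (I : Type) (s : seq I) (f : I -> vec -> R) :
  (forall k, smooth (f k)) -> smooth (fun x => \prod_(k <- s) f k x).
Proof.
move=> sf; elim: s => [|k s IHs].
  rewrite (_ : (fun _ => _) = fun=> 1); first exact: smooth_cst.
  by apply/funext => x; rewrite big_nil.
rewrite (_ : (fun _ => _) = fun x => f k x * \prod_(j <- s) f j x).
  exact: smoothM.
by apply/funext => x; rewrite big_cons.
Qed.

Lemma flat0_le1 (t : R) : flat 0 t <= 1.
Proof.
rewrite /flat; case: ifP => // t0; rewrite expr0 mul1r.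
by rewrite -[leRHS](@expR0 R) ler_expR oppr_le0 invr_ge0 ltW.
Qed.

Lemma flat0_cvg1 (l : R) : 0 < l -> flat 0 (n.+1%:R * l - 1) @[n --> \oo] --> (1 : R).
Proof.
move=> l0; apply/cvgrPdist_lt => e e0.
have [N hN] : exists N : nat, (1 + e^-1) / l < N%:R.
  exists (Num.bound ((1 + e^-1) / l)); apply: archi_boundP.
  by rewrite divr_ge0 ?(ltW l0)// addr_ge0// invr_ge0 ltW.
near=> n.
have Nn : N%:R <= n.+1%:R :> R.
  by rewrite ler_nat; apply: leqW; near: n; exact: nbhs_infty_ge.
have tn : e^-1 < n.+1%:R * l - 1.
  rewrite ltrBrDl -ltr_pdivrMr//; exact: lt_le_trans Nn.
set t := _ - 1 in tn *.
have t0 : 0 < t by apply: lt_trans tn; rewrite invr_gt0.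
rewrite ger0_norm ?subr_ge0 ?flat0_le1// /flat t0 expr0 mul1r.
have := expR_ge1Dx (- t^-1); have : t^-1 < e.
  by rewrite -[e]invrK ltf_pV2// posrE invr_gt0.
lra.
Unshelve. all: by end_near. Qed.

Let prod_flat_cvg1 (I : Type) (s : seq I) (l : I -> R) : (forall k, 0 < l k) ->
  \prod_(k <- s) flat 0 (m.+1%:R * l k - 1) @[m --> \oo] --> (1 : R).
Proof.
move=> l0; elim: s => [|k s IHs].
  by under eq_fun do rewrite big_nil; exact: cvg_cst.
have H := cvgM (flat0_cvg1 (l0 k)) IHs; rewrite mulr1 in H.
rewrite (_ : (fun _ => _) = (fun m : nat => flat 0 (m.+1%:R * l k - 1) *
  \prod_(j <- s) flat 0 (m.+1%:R * l j - 1))); first exact: H.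
by apply/funext => m; rewrite big_cons.
Qed.

Lemma test_fun_sub (U V : set vec) (f : vec -> R) :
  U `<=` V -> test_fun U f -> test_fun V f.
Proof.
by move=> UV [sf [A [cA AU A0]]]; split => //; exists A; split => // x /AU/UV.
Qed.

(* The products over k of flat 0 (n (dot (a k) x + b k) - 1) are smooth, vanish
   off a compact subset of U and converge boundedly to the indicator of U. *)
Lemma ortho_test_smooth (n : nat) (a : 'I_n -> vec) (b : 'I_n -> R)
    (U := [set x | forall k, 0 < dot (a k) x + b k]) (Z g : vec -> R) :
  bounded_set Om -> U `<=` Om -> L2 Om Z ->
  (forall phi, test_fun U phi -> ip Om Z phi = 0) -> smooth g ->
  (\int[@leb3 R]_(y in @pt R @^-1` U) (Z (pt y) * g (pt y))%:E = 0)%E.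
Proof.
move=> bOm UOm lZ Z0 sg.
pose l k (x : vec) := dot (a k) x + b k.
(* The shift by 1 makes [psi m] vanish unless every [l k x] is at least 1/(m+1), which keeps its
   support off the boundary of U. *)
pose psi (m : nat) (x : vec) : R := \prod_(k < n) flat 0 (m.+1%:R * l k x - 1).
pose phi m x := g x * psi m x.
have lc k : continuous (l k) by exact: affine_continuous.
have ol k : open (l k @^-1` [set t | 0 < t]).
  by apply: open_comp => [y _|]; [exact: lc|exact: open_gt].
have oU : open U.
  rewrite openE => x Ux; apply: (@filter_forall _ _ _ (nbhs x)) => k.
  apply: open_nbhs_nbhs; split; last exact: Ux.
  exact: ol.
have flat01 t : 0 <= flat 0 t <= (1 : R) by rewrite flat_ge0 flat0_le1.
have psi01 m x : 0 <= psi m x <= 1.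
  apply/andP; split; first by apply: prodr_ge0 => k _; exact: flat_ge0.
  by rewrite /psi; apply: prodr_ile1 => k _; exact: flat01.
have psi_supp m x : ~ (forall k, 1 <= m.+1%:R * l k x) -> psi m x = 0.
  move=> /existsNP[k /negP]; rewrite -ltNge => lk.
  by rewrite /psi (bigD1 k)//= flat_le0 ?mul0r// subr_le0 ltW.
have sphi m : smooth (phi m).
  apply: smoothM => //; apply: smooth_prod => k.
  rewrite (_ : (fun _ => _) =
    fun x => flat 0 (dot (m.+1%:R *: a k) x + (m.+1%:R * b k - 1))).
    exact: smooth_flat.
  by apply/funext => x; rewrite dotC dotZr dotC /l mulrDr addrA.
have tphi m : test_fun U (phi m).
  split; first exact: sphi.
  (* This set is closed by continuity of the [l k], and bounded since it lies in U, hence in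
     [Om]. *)
  exists [set x | forall k, 1 <= m.+1%:R * l k x]; split; last first.
  - by move=> x /psi_supp E; rewrite /phi E mulr0.
  - move=> x /= h k; have := h k.
    by move=> /(lt_le_trans (@ltr01 R)); rewrite pmulr_rgt0.
  apply: bounded_closed_compact.
    have [K [Kr hK]] := bOm; exists K; split => // M KM x /= h.
    apply: hK => //; apply: UOm => k; have := h k.
    by move=> /(lt_le_trans (@ltr01 R)); rewrite pmulr_rgt0.
  rewrite (_ : mkset _ = \bigcap_(k in [set: 'I_n])
    ((fun x => m.+1%:R * l k x) @^-1` [set t | 1 <= t])).
    apply: closed_bigI => k _; apply: closed_comp => [x _|]; last exact: closed_ge.
    by apply: (@cvgM _ _ (nbhs x) _ (cst m.+1%:R) (l k)); [exact: cvg_cst|exact: lc].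
  by apply/seteqP; split => x /= h k; [move=> _; exact: h|exact: (h k)].
have UD : (@pt R : X -> vec) @^-1` U `<=` D by move=> y /UOm.
have mU : measurable ((@pt R : X -> vec) @^-1` U) by exact: pt_measurable.
have lg := smooth_L2 bOm sg.
have lphi m := smooth_L2 bOm (sphi m).
have Iphi m : (\int[@leb3 R]_(y in @pt R @^-1` U)
    (Z (pt y) * phi m (pt y))%:E = 0)%E.
  have I := L2M_integrable lZ (lphi m).
  have h : (\int[@leb3 R]_(y in D) (Z (pt y) * phi m (pt y))%:E = 0)%E.
    move: (Z0 _ (tphi m)); rewrite /ip /Rintegral => h.
    by rewrite -[LHS]fineK ?h//; exact: integrable_fin_num.
  rewrite -[RHS]h integral_mkcond [RHS]integral_mkcond; congr integral.
  apply/funext => y; rewrite /patch; have [Uy|Uy] := pselect (U (pt y)).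
    by rewrite !ifT// inE /=; [exact: UOm|].
  rewrite ifF; last by apply/negP; rewrite inE.
  case: ifP => // _; rewrite /phi psi_supp ?mulr0// => h'; apply: Uy => k.
  by have := h' k => /(lt_le_trans (@ltr01 R)); rewrite pmulr_rgt0.
have IZg := integrableS mD mU UD (L2M_integrable lZ lg).
have H1 : {ae @leb3 R, forall y, (@pt R @^-1` U) y ->
    (Z (pt y) * phi m (pt y))%:E @[m --> \oo] --> (Z (pt y) * g (pt y))%:E}.
  apply: aeW => y Uy; apply: cvg_EFin; first by near=> m.
  have p1 := prod_flat_cvg1 (index_enum 'I_n) (fun k => Uy k).
  have H := cvgM (cvg_cst (Z (pt y))) (cvgM (cvg_cst (g (pt y))) p1).
  by rewrite mulr1 in H; exact: H.
have H2 : {ae @leb3 R, forall y m, (@pt R @^-1` U) y ->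
    (`|(Z (pt y) * phi m (pt y))%:E| <= `|(Z (pt y) * g (pt y))%:E|)%E}.
  apply: aeW => y m Uy; rewrite !abse_EFin lee_fin mulrA normrM.
  rewrite -[leRHS]mulr1; apply: ler_wpM2l => //.
  by have /andP[p0 p1] := psi01 m (pt y); rewrite ger0_norm.
have [_ _ h] := @dominated_convergence _ _ _ (@leb3 R) _ mU
  (fun m y => (Z (pt y) * phi m (pt y))%:E)
  (fun y => (Z (pt y) * g (pt y))%:E)
  (fun y => `|(Z (pt y) * g (pt y))%:E|%E)
  (fun m => measurable_int _ (integrableS mD mU UD (L2M_integrable lZ (lphi m))))
  (measurable_int _ IZg) H1 (integrable_abse IZg) H2.
have h0 : (fun m => \int[@leb3 R]_(y in @pt R @^-1` U)
    (Z (pt y) * phi m (pt y))%:E)%E = cst 0%E by apply/funext => m; exact: Iphi.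
rewrite h0 in h; apply/esym.
by apply: (cvg_unique _ _ h) => //; exact: cvg_cst.
Unshelve. all: by end_near. Qed.

Lemma integral_pieces0 (I : finType) (U : I -> set vec) (N : set vec) (h : vec -> R) :
  (forall K, measurable ((@pt R : X -> vec) @^-1` U K)) ->
  (forall K L, K != L -> U K `&` U L = set0) -> (forall K, U K `<=` Om) ->
  measurable ((@pt R : X -> vec) @^-1` N) -> leb3 ((@pt R : X -> vec) @^-1` N) = 0%E ->
  (forall x, Om x -> ~ N x -> exists K, U K x) ->
  (@leb3 R).-integrable D (EFin \o (fun y : X => h (pt y))) ->
  (forall K, \int[@leb3 R]_(y in @pt R @^-1` U K) (h (pt y))%:E = 0)%E ->
  \int[@leb3 R]_(y in D) h (pt y) = 0.
Proof.
move=> mU dU UOm mN N0 cov Ih h0.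
set PN := (@pt R : X -> vec) @^-1` N in mN N0.
pose V K : set X := (@pt R : X -> vec) @^-1` U K.
have UV : D `\` PN = (\big[setU/set0]_(K <- index_enum I) V K) `\` PN.
  apply/seteqP; split => y /= [Dy Ny]; split => //.
    have [K UK] := cov _ Dy Ny; rewrite -bigcup_seq; exists K => //=.
    exact: mem_index_enum.
  by move: Dy; rewrite -bigcup_seq => -[K _] /UOm.
have mVs : measurable (\big[setU/set0]_(K <- index_enum I) V K).
  by apply: bigsetU_measurable => K _; exact: mU.
have VD : \big[setU/set0]_(K <- index_enum I) V K `<=` D.
  by move=> y; rewrite -bigcup_seq => -[K _] /UOm.
have IV := integrableS mD mVs VD Ih.
rewrite /Rintegral (negligible_integral mN mD Ih N0) UV.
rewrite -(negligible_integral mN mVs IV N0) integral_bigsetU_EFin//.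
- by rewrite big1// => K _; exact: h0.
- exact: index_enum_uniq.
- apply/trivIsetP => K L _ _ KL; rewrite /V -preimage_setI dU//.
- exact: measurable_int IV.
Qed.

End L2Algebra.

(** * Barycentric coordinates, traces and normals on one tetrahedron *)

Section Tetrahedra.
Variables (R : realType) (v : 'I_4 -> 'rV[R]_3).
Hypothesis ndv : Defs.nondegenerate v.
Local Notation vec := 'rV[R]_3.

Let M : 'M[R]_3 := \matrix_(i < 3) (v (lift ord0 i) - v ord0).
(** The columns of the inverse edge matrix are the gradients of the barycentric coordinates of the
    vertices other than [v ord0]; the remaining gradient is minus their sum, because the coordinates
    add up to 1. *)
Let c (j : 'I_3) : vec := (col j (invmx M))^T.

Let dot_c (j : 'I_3) (x : vec) : dot (c j) x = (x *m invmx M) 0 j.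
Proof. by rewrite dotC mxE; apply: eq_bigr => i _; rewrite !mxE. Qed.

Definition bary_lin (k : 'I_4) : vec :=
  if unlift ord0 k is Some j then c j else - \sum_j c j.

Definition bary_cst (k : 'I_4) : R :=
  if unlift ord0 k is Some j then - dot (c j) (v ord0)
  else 1 + \sum_j dot (c j) (v ord0).

Definition bary (k : 'I_4) (x : vec) : R := dot (bary_lin k) x + bary_cst k.

Let dot_sum (x : vec) : dot (- \sum_j c j) x = - \sum_j dot (c j) x.
Proof.
rewrite dotC -scaleN1r dotZr mulN1r; congr (- _).
by elim/big_rec2: _ => [|j y u _ <-]; rewrite ?dot0r// dotDr dotC.
Qed.

Let bary0 (x : vec) : bary ord0 x = 1 - \sum_j dot (c j) (x - v ord0).
Proof.
rewrite /bary /bary_lin /bary_cst unlift_none dot_sum.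
under [in RHS]eq_bigr do rewrite dotBr.
by rewrite sumrB; ring.
Qed.

Let baryS (j : 'I_3) (x : vec) : bary (lift ord0 j) x = dot (c j) (x - v ord0).
Proof. by rewrite /bary /bary_lin /bary_cst liftK dotBr. Qed.

Lemma bary_sum (x : vec) : \sum_k bary k x = 1.
Proof.
rewrite big_ord_recl bary0; under [X in _ + X]eq_bigr do rewrite baryS.
by rewrite subrK.
Qed.

Lemma bary_eq (x : vec) : x = \sum_k bary k x *: v k.
Proof.
rewrite big_ord_recl bary0; under [X in _ + X]eq_bigr do rewrite baryS.
have : (x - v ord0) *m invmx M *m M = x - v ord0 by rewrite mulmxKV.
rewrite mulmx_sum_row => E; apply: (addIr (- v ord0)); rewrite -[LHS]E.
have rM j : row j M = v (lift ord0 j) - v ord0 by rewrite rowK.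
rewrite (eq_bigr (fun j => dot (c j) (x - v ord0) *: v (lift ord0 j)
    - dot (c j) (x - v ord0) *: v ord0)); last first.
  by move=> j _; rewrite rM scalerBr dot_c.
rewrite sumrB scalerBl scale1r scaler_suml.
have aux (p q r : vec) : p - q = r - q + p - r.
  by rewrite [RHS]addrAC [r - q]addrC addrK addrC.
exact: aux.
Qed.

Lemma bary_vertex (k l : 'I_4) : bary k (v l) = (k == l)%:R.
Proof.
have muE j : dot (c j) (v l - v ord0) = (lift ord0 j == l)%:R.
  case: (unliftP ord0 l) => [i ->|->]; last first.
    by rewrite subrr dot0r eq_sym (negPf (neq_lift _ _)).
  rewrite dot_c (inj_eq lift_inj) -[v _ - _](rowK (fun i => v (lift ord0 i) - v ord0)).
  by rewrite -row_mul mulmxV// !mxE eq_sym.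
case: (unliftP ord0 k) => [j ->|->]; first by rewrite baryS muE.
rewrite bary0; under eq_bigr do rewrite muE.
case: (unliftP ord0 l) => [i ->|->]; last first.
  by rewrite big1 ?subr0// => j _; rewrite eq_sym (negPf (neq_lift _ _)).
rewrite (bigD1 i)//= eqxx big1 ?addr0 ?subrr ?(negPf (neq_lift _ _))// => j ji.
by rewrite (inj_eq lift_inj) (negPf ji).
Qed.

Lemma bary_lin_neq0 (k : 'I_4) : bary_lin k != 0.
Proof.
have [l lk] : exists l : 'I_4, l != k.
  by exists (lift k ord0); rewrite eq_sym neq_lift.
apply/eqP => a0; have := bary_vertex k k; have := bary_vertex k l.
rewrite /bary a0 !dot0l !add0r eq_sym (negPf lk) eqxx => -> /eqP.
by rewrite eq_sym oner_eq0.
Qed.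

Lemma bary_continuous (k : 'I_4) : continuous (bary k).
Proof. exact: affine_continuous. Qed.

Lemma bary_comb (k : 'I_4) (w : 'I_4 -> R) : \sum_l w l = 1 ->
  bary k (\sum_l w l *: v l) = w k.
Proof.
move=> w1; transitivity (\sum_l w l * bary k (v l)).
  rewrite /bary; under [RHS]eq_bigr do rewrite mulrDr.
  rewrite big_split /= -mulr_suml w1 mul1r; congr (_ + _).
  by elim/big_rec2: _ => [|l y u _ <-]; rewrite ?dot0r// dotDr dotZr.
rewrite (bigD1 k)//= bary_vertex eqxx mulr1 big1 ?addr0// => l lk.
by rewrite bary_vertex eq_sym (negPf lk) mulr0.
Qed.

Lemma hull_bary (S : {set 'I_4}) (x : vec) : hull v S x <->
  (forall k, 0 <= bary k x) /\ (forall k, k \notin S -> bary k x = 0).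
Proof.
split=> [[w [w0 wS w1 ->]]|[b0 bS]].
  by split=> k; rewrite bary_comb//; exact: wS.
by exists (bary^~ x); split; [|exact: bS|exact: bary_sum|exact: bary_eq].
Qed.

Lemma tet_bary : tet v = [set x | forall k, 0 <= bary k x].
Proof.
apply/seteqP; split => x /=; rewrite /tet hull_bary; first by case.
by move=> h; split => // k; rewrite inE.
Qed.

Lemma face_tet (i : 'I_4) : face v i `<=` tet v.
Proof. by move=> x; rewrite /face /tet !hull_bary => -[? _]; split => // k; rewrite inE. Qed.

Lemma tet_closed : closed (tet v).
Proof.
rewrite tet_bary (_ : mkset _ =
  \bigcap_(k in [set: 'I_4]) (bary k @^-1` [set t | 0 <= t])).
  apply: closed_bigI => k _; apply: closed_comp => [x _|]; last exact: closed_ge.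
  exact: bary_continuous.
by apply/seteqP; split => x /= h k; [move=> _; exact: h|exact: (h k)].
Qed.

Lemma interior_tet : (tet v)° = [set x | forall k, 0 < bary k x].
Proof.
apply/seteqP; split => x /=.
  rewrite tet_bary => xint k.
  have : 0 <= bary k x by have /= := interior_subset xint k.
  rewrite le_eqVlt => /predU1P[bk|//]; exfalso.
  (* If the k-th coordinate vanished at x, a small step against its gradient would make it negative
     and leave the tetrahedron. *)
  pose y (t : R) : vec := x - t *: bary_lin k.
  have cy : continuous y.
    move=> t; apply: cvgB; first exact: cvg_cst.
    by apply: cvgZr_tmp; exact: cvg_id.
  have y0 : y 0 = x by rewrite /y scale0r subr0.
  have near_y : nbhs (y 0) [set z | forall k, 0 <= bary k z].
    by rewrite y0; exact: xint.
  have := cy 0 _ near_y; move=> /nbhs_ballP[e /= e0 /(_ (e / 2))]; rewrite /ball/= sub0r normrN.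
  rewrite ger0_norm ?divr_ge0 ?ltW// ltr_pdivrMr// ltr_pMr// ltr1n.
  move=> /(_ isT k); rewrite /bary /y dotBr dotZr addrAC -/(bary k x) -bk sub0r.
  rewrite oppr_ge0 leNgt; apply/negP/negPn; rewrite mulr_gt0 ?divr_gt0//.
  rewrite lt_def; apply/andP; split.
    apply: contra (bary_lin_neq0 k) => /eqP.
    rewrite /dot => h; apply/eqP/rowP => j; rewrite mxE; apply/eqP.
    rewrite -sqrf_eq0 expr2; apply/eqP.
    by apply: (psumr_eq0P _ h) => // l _; rewrite -expr2 sqr_ge0.
  by apply: sumr_ge0 => l _; rewrite -expr2 sqr_ge0.
move=> xb; apply: filterS (_ : nbhs x [set z | forall k, 0 < bary k z]).
  by rewrite tet_bary => z /= zb k; apply: ltW.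
apply: (@filter_forall _ _ _ (nbhs x)) => k.
have nb : nbhs (bary k x) [set t | 0 < t].
  by apply: open_nbhs_nbhs; split; [exact: open_gt|exact: xb].
exact: (@bary_continuous k x _ nb).
Qed.

(** Moving x towards the barycentre m, whose coordinates are all 1/4, makes every coordinate
    positive at once. *)
Lemma closure_interior_tet (x : vec) : tet v x -> closure (tet v)° x.
Proof.
move=> xt A nA.
pose m : vec := \sum_k 4^-1 *: v k.
pose y (t : R) : vec := (1 - t) *: x + t *: m.
have cy : continuous y.
  move=> t; apply: cvgD; apply: cvgZr_tmp; last exact: cvg_id.
  by apply: cvgB; [exact: cvg_cst|exact: cvg_id].
have y0 : y 0 = x by rewrite /y scale0r subr0 scale1r addr0.
have : \forall t \near (0 : R), A (y t) by apply: (cy 0); rewrite y0.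
move=> /nbhs_ballP[e /= e0 eA].
pose t := Num.min 1 (e / 2).
have t0 : 0 < t by rewrite lt_min ltr01 divr_gt0.
have t1 : t <= 1 by rewrite ge_min lexx.
exists (y t); split; last first.
  apply: eA; rewrite /ball/= sub0r normrN gtr0_norm//.
  apply: (@le_lt_trans _ _ (e / 2)); first by rewrite ge_min lexx orbT.
  by rewrite ltr_pdivrMr// ltr_pMr// ltr1n.
rewrite interior_tet => k.
have bm : bary k m = 4^-1.
  rewrite (@bary_comb k (fun=> 4^-1))// sumr_const card_ord.
  by rewrite -[LHS]mulr_natl mulfV.
have -> : bary k (y t) = (1 - t) * bary k x + t * bary k m.
  by rewrite /bary /y dotDr !dotZr; ring.
rewrite bm ltr_wpDl ?mulr_gt0// mulr_ge0 ?subr_ge0//.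
by move: xt; rewrite tet_bary.
Qed.

(** Since x adheres to the interior, the filter in [inner_trace] is proper, and [lim] returns the
    constant and not a default value. *)
Lemma inner_trace_cst (F : vec -> vec) (a x : vec) :
  (forall z, (tet v)° z -> F z = a) -> tet v x -> inner_trace v F x = a.
Proof.
move=> Fa /closure_interior_tet xt.
have PF : ProperFilter (within (tet v)° (nbhs x)) by exact: within_nbhs_proper.
apply: cvg_lim; first exact: norm_hausdorff.
apply: cvg_near_cst.
by rewrite near_withinE; apply: nearW => z; exact: Fa.
Qed.

Lemma vertex_face (i : 'I_4) (k : 'I_3) : face v i (v (lift i k)).
Proof.
rewrite /face hull_bary; split => l; rewrite bary_vertex//.
rewrite !inE negbK => /eqP ->; by rewrite (negPf (neq_lift _ _)).
Qed.

(** An affine function that vanishes on the face has a gradient a orthogonal to both edges, and the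
    triple product expands as (a.q) p - (a.p) q. This is how zero boundary values of a potential
    become a zero tangential trace of its gradient. *)
Lemma cross_area_vec0 (a : vec) (b : R) (i : 'I_4) :
  (forall x, face v i x -> dot a x + b = 0) -> cross a (area_vec v i) = 0.
Proof.
move=> ab.
have e k l : dot a (v (lift i k) - v (lift i l)) = 0.
  rewrite dotBr; have := ab _ (vertex_face i k); have := ab _ (vertex_face i l).
  by move=> /eqP; rewrite addr_eq0 => /eqP -> /eqP; rewrite addr_eq0 => /eqP ->; rewrite subrr.
have := e 1 0; have := e 2%:R 0; rewrite -/(edge1 v i) -/(edge2 v i) => e2 e1.
have trip (p q : vec) : cross a (cross p q) = dot a q *: p - dot a p *: q.
  have o11 : (1 + 1 : 'I_3) = 2%:R by exact: val_inj.
  have o12 : (1 + 2%:R : 'I_3) = 0 by exact: val_inj.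
  have o21 : (2%:R + 1 : 'I_3) = 0 by exact: val_inj.
  have o22 : (2%:R + 2%:R : 'I_3) = 1 by exact: val_inj.
  have oE := (add0r, o11, o12, o21, o22).
  by apply/rowP; apply: ord3P; rewrite /dot !sum3 !mxE ?oE; ring.
by rewrite /area_vec trip e1 e2 !scale0r subrr.
Qed.

Lemma cross_face_normal0 (a : vec) (b : R) (i : 'I_4) :
  (forall x, face v i x -> dot a x + b = 0) -> cross a (face_normal v i) = 0.
Proof.
move=> /cross_area_vec0 h; rewrite /face_normal; set s := _ / _.
apply/rowP => j; have /rowP/(_ j) := h; rewrite !mxE => E.
by rewrite !(mulrCA _ s) -mulrBr E mulr0.
Qed.

Lemma face_param (i : 'I_4) (s t : R) : 0 <= s -> 0 <= t -> s + t <= 1 ->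
  face v i (v (lift i 0) + s *: edge1 v i + t *: edge2 v i).
Proof.
move=> s0 t0 st.
have E (k : 'I_4) : bary k (v (lift i 0) + s *: edge1 v i + t *: edge2 v i) =
    (1 - s - t) * bary k (v (lift i 0)) + s * bary k (v (lift i 1))
    + t * bary k (v (lift i 2%:R)).
  by rewrite /bary /edge1 /edge2 !dotDr !dotZr !dotBr; ring.
rewrite /face hull_bary; split => k; rewrite E !bary_vertex.
  by rewrite !addr_ge0// mulr_ge0// -addrA -opprD subr_ge0.
rewrite !inE negbK => /eqP ->; by rewrite !(negPf (neq_lift _ _)) !mulr0 !addr0.
Qed.

End Tetrahedra.

(** * Vector fields in L^2, test fields, and the weak gradient of an affine function *)

Section VectorL2.
Variables (R : realType) (Om : set 'rV[R]_3).
Hypotheses (oOm : open Om) (bOm : bounded_set Om).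
Local Notation vec := 'rV[R]_3.
Local Notation X := (measurableTypeR R * measurableTypeR R * measurableTypeR R)%type.

Lemma L2vB (F G : vec -> vec) : L2v Om F -> L2v Om G -> L2v Om (F \- G).
Proof.
move=> lF lG i; apply: (@eq_L2 _ _ (fun x => F x 0 i - G x 0 i)).
  by move=> x _; rewrite /coordf /= !mxE.
exact: (L2B (lF i) (lG i)).
Qed.

Lemma L2v_mid (F G : vec -> vec) (c : R) : L2v Om F -> L2v Om G ->
  L2v Om (fun x => c *: (F x + G x)).
Proof.
move=> lF lG i; apply: (@eq_L2 _ _ (fun x => c * (F x 0 i + G x 0 i))).
  by move=> x _; rewrite /coordf !mxE.
exact: (L2Z c (L2D (lF i) (lG i))).
Qed.

Lemma Rintegral_eq0 d (Y : measurableType d) (m : {measure set Y -> \bar R})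
    (D : set Y) (f : Y -> R) : (forall y, D y -> f y = 0) ->
  \int[m]_(y in D) f y = 0.
Proof. by move=> f0; rewrite /Rintegral integral0_eq// => y /f0 ->. Qed.

Lemma ipvC (F G : vec -> vec) : ipv Om F G = ipv Om G F.
Proof. by apply: eq_Rintegral => y _; rewrite dotC. Qed.

Lemma ipvBl (F G H : vec -> vec) : L2v Om F -> L2v Om G -> L2v Om H ->
  ipv Om (F \- G) H = ipv Om F H - ipv Om G H.
Proof.
move=> lF lG lH; rewrite !ipv_sum//; last exact: L2vB.
rewrite -sumrB; apply: eq_bigr => i _; rewrite -ipBl//.
by apply: eq_ip => // x _; rewrite /coordf /= !mxE.
Qed.

Lemma ipvZl (c : R) (F G : vec -> vec) : L2v Om F -> L2v Om G ->
  ipv Om (fun x => c *: F x) G = c * ipv Om F G.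
Proof.
move=> lF lG.
have E i : coordf (fun x => c *: F x) i = fun x => c * coordf F i x.
  by apply/funext => x; rewrite /coordf mxE.
rewrite !ipv_sum//; last by move=> i; rewrite E; exact: L2Z.
by rewrite mulr_sumr; apply: eq_bigr => i _; rewrite E ipZl.
Qed.

Lemma ipv_mid (F G H : vec -> vec) (c : R) :
  L2v Om F -> L2v Om G -> L2v Om H ->
  ipv Om (fun x => c *: (F x + G x)) H = c * (ipv Om F H + ipv Om G H).
Proof.
move=> lF lG lH; rewrite !ipv_sum//; last exact: L2v_mid.
rewrite -big_split mulr_sumr; apply: eq_bigr => i _ /=.
rewrite -ipDl// -ipZl//; last exact: L2D.
by apply: eq_ip => // x _; rewrite /coordf !mxE.
Qed.

(** Testing with f times the i-th unit vector turns the vector identities that define weak gradients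
    and curls into scalar ones, component by component. *)
Definition single (i : 'I_3) (f : vec -> R) : vec -> vec :=
  fun x => \row_j (if j == i then f x else 0).

Lemma coordf_single i (f : vec -> R) j :
  coordf (single i f) j = if j == i then f else fun=> 0.
Proof. by apply/funext => x; rewrite /coordf mxE; case: eqP. Qed.

Lemma ipv_single (F : vec -> vec) i (f : vec -> R) :
  ipv Om F (single i f) = ip Om (coordf F i) f.
Proof.
apply: eq_Rintegral => y _; rewrite /dot (bigD1 i)//= big1 => [|j ji].
  by rewrite mxE eqxx addr0.
by rewrite mxE (negPf ji) mulr0.
Qed.

Lemma partial_cst i (c : R) (x : vec) : partial i (fun=> c) x = 0.
Proof. by rewrite partialE derive_cst. Qed.

Lemma divg_single i (f : vec -> R) : divg (single i f) = partial i f.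
Proof.
apply/funext => x; rewrite /divg (bigD1 i)//= big1 => [|j ji].
  by rewrite coordf_single eqxx addr0.
by rewrite coordf_single (negPf ji) partial_cst.
Qed.

Lemma test_fun0 (U : set vec) : test_fun U (fun=> 0).
Proof.
split; first exact: smooth_cst.
by exists set0; split => //; exact: compact0.
Qed.

Lemma test_field_single (U : set vec) i (f : vec -> R) :
  test_fun U f -> test_field U (single i f).
Proof.
by move=> tf j; rewrite coordf_single; case: eqP => _ //; exact: test_fun0.
Qed.

Lemma test_fun_partial (U : set vec) i (f : vec -> R) :
  test_fun U f -> test_fun U (partial i f).
Proof.
move=> [sf [A [cA AU A0]]]; split; first exact: smooth_partial.
exists A; split => //; apply: partial_support => //.
by apply: compact_closed => //; exact: norm_hausdorff.
Qed.

Lemma test_funB (U : set vec) (f g : vec -> R) :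
  test_fun U f -> test_fun U g -> test_fun U (fun x => f x - g x).
Proof.
move=> [sf [A [cA AU A0]]] [sg [B [cB BU B0]]]; split; first exact: smoothB.
exists (A `|` B); split; first exact: compactU.
  by move=> x [/AU|/BU].
by move=> x /not_orP[/A0 -> /B0 ->]; rewrite subrr.
Qed.

Lemma test_field_curl (U : set vec) (F : vec -> vec) :
  test_field U F -> test_field U (curl F).
Proof.
move=> tF i; rewrite (_ : coordf _ _ = fun x =>
  partial (i + 1) (coordf F (i + 2%:R)) x
  - partial (i + 2%:R) (coordf F (i + 1)) x).
  by apply: test_funB; apply: test_fun_partial; exact: tF.
by apply/funext => x; rewrite /coordf mxE.
Qed.

Lemma divg_curl (F : vec -> vec) :
  (forall i, smooth (coordf F i)) -> divg (curl F) = fun=> 0.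
Proof.
move=> sF; apply/funext => x; rewrite /divg.
have E i : partial i (coordf (curl F) i) x =
    partial i (partial (i + 1) (coordf F (i + 2%:R))) x
    - partial i (partial (i + 2%:R) (coordf F (i + 1))) x.
  rewrite -partialB; [|exact: smooth_partial|exact: smooth_partial].
  by congr (partial i _ x); apply/funext => z; rewrite /coordf mxE.
have o11 : (1 + 1 : 'I_3) = 2%:R by exact: val_inj.
have o12 : (1 + 2%:R : 'I_3) = 0 by exact: val_inj.
have o21 : (2%:R + 1 : 'I_3) = 0 by exact: val_inj.
have o22 : (2%:R + 2%:R : 'I_3) = 1 by exact: val_inj.
rewrite sum3 !E !(add0r, o11, o12, o21, o22).
rewrite (partialC 1 0 x (sF 2%:R)) (partialC 2%:R 0 x (sF 1)).
rewrite (partialC 2%:R 1 x (sF 0)).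
move: (partial 0 (partial 1 _) x) (partial 0 (partial 2%:R _) x)
  (partial 1 (partial 2%:R _) x) => p q r; ring.
Qed.

Lemma test_fun_L2 (U : set vec) (f : vec -> R) : test_fun U f -> L2 Om f.
Proof. by move=> [sf _]; exact: smooth_L2. Qed.

Lemma test_field_L2v (U : set vec) (F : vec -> vec) : test_field U F -> L2v Om F.
Proof. by move=> tF i; apply: test_fun_L2. Qed.

(** Test functions supported in U see f only where it is affine, so f may be replaced by its
    formula; integrating the derivative of [(dot a x + b) * phi x] to 0 then moves the derivative
    off phi. *)
Lemma wgrad_affine (f : vec -> R) (W : vec -> vec) (U : set vec) (a : vec)
    (b : R) (phi : vec -> R) (i : 'I_3) :
  is_wgrad Om f W -> U `<=` Om -> (forall x, U x -> f x = dot a x + b) ->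
  test_fun U phi -> ip Om (coordf W i) phi = ip Om (fun=> a 0 i) phi.
Proof.
move=> [lW wW] UOm fab tphi.
have tphiOm := test_fun_sub UOm tphi.
have := wW _ (test_field_single i tphiOm).
rewrite divg_single ipv_single => E; rewrite -[LHS]opprK -E.
have lphi := test_fun_L2 tphi.
have ldphi := test_fun_L2 (test_fun_partial i tphi).
have laff := smooth_L2 oOm bOm (smooth_affine a b).
have lc := cst_L2 oOm (a 0 i) bOm.
have [sphi [A [cA AU A0]]] := tphi.
have clA : closed A by apply: compact_closed => //; exact: norm_hausdorff.
have dA0 := partial_support i clA A0.
have -> : ip Om f (partial i phi) = ip Om (fun x => dot a x + b) (partial i phi).
  apply: eq_Rintegral => y _; have [Ay|Ay] := pselect (A (pt y)).
    by rewrite fab//; exact: AU.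
  by rewrite dA0// !mulr0.
apply/eqP; rewrite eqr_oppLR -addr_eq0; apply/eqP.
have z0 x : ~ A x -> (dot a x + b) * phi x = 0 by move=> /A0 ->; rewrite mulr0.
rewrite -[RHS](Rintegral_partial i (smoothM (smooth_affine a b) sphi) cA z0).
have mOm := pt_measurable oOm.
have I1 := L2M_integrable oOm laff ldphi; have I2 := L2M_integrable oOm lc lphi.
rewrite /ip -RintegralD//.
rewrite Rintegral_mkcond; apply: eq_Rintegral => y _.
rewrite partialM//; last exact: smooth_affine.
rewrite partial_affine /patch; case: ifPn => [_|Dy]; first by rewrite [phi _ * _]mulrC.
have Ay : ~ A (pt y) by move=> /AU/UOm Oy; move/negP: Dy; apply; rewrite inE.
by rewrite dA0// A0// mul0r mulr0 addr0.
Qed.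

End VectorL2.

(** * Piecewise affine potentials on the mesh: cellwise gradients and boundary values *)

Section Elements.
Variables (R : realType) (Om Gi : set 'rV[R]_3).
Variables (I : finType) (T : I -> 'I_4 -> 'rV[R]_3).
Hypotheses (hOm : shell Om Gi) (hT : conforming Om T).
Local Notation vec := 'rV[R]_3.
Local Notation X := (measurableTypeR R * measurableTypeR R * measurableTypeR R)%type.
Local Notation cell K := ((tet (T K))°).

Let oOm : open Om. Proof. exact: shell_open hOm. Qed.
Let bOm : bounded_set Om. Proof. exact: shell_bounded hOm. Qed.
Let nd K : Defs.nondegenerate (T K). Proof. exact: conf_nondegenerate hT K. Qed.

Lemma tet_closure K : tet (T K) `<=` closure Om.
Proof. by rewrite (conf_cover hT) => x xK; exists K. Qed.

Lemma cell_Om K : cell K `<=` Om.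
Proof. by rewrite -[X in _ `<=` X](conf_regular hT); apply/interiorS/tet_closure. Qed.

Lemma Om_tet x : Om x -> exists K, tet (T K) x.
Proof.
move=> /subset_closure; rewrite (conf_cover hT) => -[K _ xK].
by exists K.
Qed.

(** The whole planes that carry the faces: a finite union of null hyperplanes, off which every point
    of [Om] lies in an open cell. *)
Let faces : set vec := [set x | exists K k, bary (T K) k x = 0].

Let cell_cover x : Om x -> ~ faces x -> exists K, cell K x.
Proof.
move=> /Om_tet[K xK] nf; exists K; rewrite interior_tet// => k.
move: xK; rewrite tet_bary// => /(_ k); rewrite le_eqVlt => /predU1P[E|//].
by exfalso; apply: nf; exists K, k.
Qed.

Let faces_null : measurable ((@pt R : X -> vec) @^-1` faces) /\
  leb3 ((@pt R : X -> vec) @^-1` faces) = 0%E.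
Proof.
pose F (f : I * 'I_4) : set X := @pt R @^-1` [set x | bary (T f.1) f.2 x = 0].
have -> : (@pt R : X -> vec) @^-1` faces = \big[setU/set0]_(f <- index_enum _) F f.
  apply/seteqP; split => y; rewrite -bigcup_seq /=.
    by move=> [K [k E]]; exists (K, k) => //=; exact: mem_index_enum.
  by move=> [[K k] _ E]; exists K, k.
have mF f : measurable (F f).
  apply: pt_measurable_closed.
  by apply: (@closed_comp _ _ (bary (T f.1) f.2) [set 0]) => [x _|];
    [exact: bary_continuous|exact: closed_eq].
have F0 f : leb3 (F f) = 0%E by apply: null_hyperplane; exact: bary_lin_neq0.
split; first by apply: bigsetU_measurable => f _; exact: mF.
elim: (index_enum _) => [|f s IHs]; first by rewrite big_nil measure0.
rewrite big_cons null_set_setU//.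
  by apply: bigsetU_measurable => g _; exact: mF.
exact: F0.
Qed.

Definition piecewise_smooth (f : vec -> R) : Prop :=
  L2 Om f /\ forall K, exists2 g, smooth g & forall x, cell K x -> f x = g x.

Lemma smooth_piecewise (f : vec -> R) : smooth f -> piecewise_smooth f.
Proof. by move=> sf; split; [exact: smooth_L2|move=> K; exists f]. Qed.

(** A fundamental lemma of the calculus of variations, cell by cell: each open cell is cut out by
    its four barycentric inequalities, so [ortho_test_smooth] applies there, and the cells fill [Om]
    up to a null set. *)
Lemma ortho_piecewise (Z f : vec -> R) : L2 Om Z -> piecewise_smooth f ->
  (forall K phi, test_fun (cell K) phi -> ip Om Z phi = 0) -> ip Om Z f = 0.
Proof.
move=> lZ [lf pf] Z0; have [mN N0] := faces_null.
have mc K : measurable ((@pt R : X -> vec) @^-1` cell K).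
  by apply: pt_measurable; exact: open_interior.
apply: (@integral_pieces0 R Om oOm I (fun K => cell K) faces (fun x => Z x * f x)) => //.
- by move=> K L; exact: conf_disjoint hT K L.
- exact: cell_Om.
- exact: L2M_integrable.
move=> K; have [g sg fg] := pf K.
have := @ortho_test_smooth R Om oOm 4 (bary_lin (T K)) (bary_cst (T K)) Z g bOm.
rewrite -[mkset _]/([set x | forall k, 0 < bary (T K) k x]) -interior_tet//.
move=> /(_ (@cell_Om K) lZ (Z0 K) sg) <-.
by apply: eq_integral => y; rewrite inE /= => yK; rewrite fg.
Qed.

(* wgrad is only a representative modulo null sets, while traces and the local
   form of fields in Himp_curl require the one that is constant in each cell. *)
Definition pwconst (a : I -> vec) : vec -> vec :=
  fun x => \sum_K (`[< cell K x >])%:R *: a K.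

Lemma pwconst_cell (a : I -> vec) K x : cell K x -> pwconst a x = a K.
Proof.
move=> xK; rewrite /pwconst (bigD1 K)//= big1 => [|L LK].
  by rewrite asboolT// scale1r addr0.
rewrite asboolF ?scale0r// => xL.
by have : (cell L `&` cell K) x by []; rewrite (conf_disjoint hT LK).
Qed.

Let coordf_pwconst (a : I -> vec) i :
  coordf (pwconst a) i = fun x => \sum_K (`[< cell K x >])%:R * a K 0 i.
Proof.
by apply/funext => x; rewrite /coordf /pwconst summxE; apply: eq_bigr => K _; rewrite mxE.
Qed.

Lemma pwconst_bound (a : I -> vec) : exists2 M, 0 <= M &
  forall i x, `|coordf (pwconst a) i x| <= M.
Proof.
exists (\sum_K \sum_i `|a K 0 i|); first by apply: sumr_ge0 => K _; exact: sumr_ge0.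
move=> i x; rewrite coordf_pwconst; apply: le_trans (ler_norm_sum _ _ _) _.
apply: ler_sum => K _; rewrite (bigD1 i)//=.
apply: (@le_trans _ _ `|a K 0 i|); last by rewrite lerDl sumr_ge0.
rewrite normrM; case: (`[< _ >]); first by rewrite normr1 mul1r.
by rewrite normr0 mul0r.
Qed.

Lemma pwconst_L2v (a : I -> vec) : L2v Om (pwconst a).
Proof.
move=> i; have [M _ aM] := pwconst_bound a.
apply: (L2_bounded oOm bOm _ (fun x _ => aM i x)).
rewrite coordf_pwconst.
apply: (@measurable_sum _ _ _ _ _ _ (fun K (y : X) => (`[< cell K (pt y) >])%:R * a K 0 i)).
move=> K; apply: measurable_funM => //.
rewrite (_ : (fun _ => _) = \1_((@pt R : X -> vec) @^-1` cell K)).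
  apply: measurable_indic; apply: pt_measurable; exact: open_interior.
by apply/funext => y; rewrite indicE; congr (nat_of_bool _)%:R.
Qed.

Lemma pwconst_piecewise (a : I -> vec) i : piecewise_smooth (coordf (pwconst a) i).
Proof.
split; first exact: pwconst_L2v.
move=> K; exists (fun=> a K 0 i); first exact: smooth_cst.
by move=> x xK; rewrite /coordf (pwconst_cell a xK).
Qed.

(** The form in which W and the cellwise gradient are the same field: on test functions of a cell
    both act as the constant [a K 0 i]. *)
Lemma wgrad_ortho (f : vec -> R) (W : vec -> vec) (a : I -> vec) (b : I -> R)
    (g : vec -> R) i : is_wgrad Om f W ->
  (forall K x, cell K x -> f x = dot (a K) x + b K) -> piecewise_smooth g ->
  ip Om (fun x => coordf W i x - coordf (pwconst a) i x) g = 0.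
Proof.
move=> wW fab pg; have lW := wW.1; have lG := pwconst_L2v a.
apply: ortho_piecewise => //; first exact: L2B (lW i) (lG i).
move=> K phi tphi; have lphi := test_fun_L2 oOm bOm tphi.
rewrite ipBl//; apply/eqP; rewrite subr_eq0; apply/eqP.
rewrite (wgrad_affine oOm bOm i wW (@cell_Om K) (fab K) tphi).
apply: eq_Rintegral => y _; have [yK|yK] := pselect (cell K (pt y)).
  by rewrite /coordf (pwconst_cell a yK).
have [_ [A [_ AU A0]]] := tphi.
by rewrite A0 ?mulr0// => /AU.
Qed.

(** Stated for any weak gradient and not only for [H0_grad], so that it covers the averaged
    pressure, which is controlled only inside [Om]. *)
Lemma ipv_wgrad_pwconst (f : vec -> R) (W : vec -> vec) (a c : I -> vec) (b : I -> R) :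
  is_wgrad Om f W -> (forall K x, cell K x -> f x = dot (a K) x + b K) ->
  ipv Om W (pwconst c) = ipv Om (pwconst a) (pwconst c).
Proof.
move=> wW fab; have lW := wW.1; have la := pwconst_L2v a; have lc := pwconst_L2v c.
rewrite !ipv_sum//; apply: eq_bigr => i _; apply/eqP; rewrite -subr_eq0 -ipBl//.
by apply/eqP/(wgrad_ortho i wW fab)/pwconst_piecewise.
Qed.

Section DiscretePotential.
Variables (q : vec -> R) (a : I -> vec) (b : I -> R).
Hypotheses (Hq : H0_grad Om T q).
Hypothesis (qab : forall K x, tet (T K) x -> q x = dot (a K) x + b K).
Let W := wgrad Om q.
Let G := pwconst a.

Let qcell K x : cell K x -> q x = dot (a K) x + b K.
Proof. by move=> /interior_subset; exact: qab. Qed.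

Let wW : is_wgrad Om q W.
Proof. by case: Hq => -[[_ ex] _] _; exact: (getPex ex). Qed.

Let lW : L2v Om W := wW.1.
Let lG : L2v Om G := pwconst_L2v a.

Let approx : exists phi : nat -> vec -> R, [/\ forall n, test_fun Om (phi n),
  ip Om (fun x => q x - phi n x) (fun x => q x - phi n x) @[n --> \oo] --> (0 : R) &
  forall i, ip Om (fun x => coordf W i x - partial i (phi n) x)
       (fun x => coordf W i x - partial i (phi n) x) @[n --> \oo] --> (0 : R)].
Proof.
case: Hq => -[_ [phi [tphi c1 c2]]] _; exists phi; split => // i.
have lgr n : L2v Om (grad (phi n)).
  move=> j; rewrite (_ : coordf _ _ = partial j (phi n)).
    by apply: (test_fun_L2 oOm bOm); apply: test_fun_partial; exact: tphi.
  by apply/funext => x; rewrite /coordf mxE.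
have E n j : ip Om (coordf (W \- grad (phi n)) j) (coordf (W \- grad (phi n)) j) =
    ip Om (fun x => coordf W j x - partial j (phi n) x)
      (fun x => coordf W j x - partial j (phi n) x).
  by apply: eq_ip => x _; rewrite /coordf /= !mxE.
apply: (squeeze_cvgr _ (cvg_cst 0) c2); near=> n.
rewrite ip_ge0 /= ipv_sum//; try exact: L2vB.
rewrite (bigD1 i)//= E lerDl; apply: sumr_ge0 => j _; exact: ip_ge0.
Unshelve. all: by end_near. Qed.

(* W - G is orthogonal to piecewise smooth functions, hence to G and to the
   derivatives of the approximating test functions, whose limit is W. *)
Let WG_null i : ip Om (fun x => coordf W i x - coordf G i x)
  (fun x => coordf W i x - coordf G i x) = 0.
Proof.
have [phi [tphi _ c2]] := approx.
have lWG := L2B (lW i) (lG i).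
have ld n := test_fun_L2 oOm bOm (test_fun_partial i (tphi n)).
have := ip_cvg0 oOm (fun n => L2B (lW i) (ld n)) lWG (c2 i).
rewrite (_ : (fun _ => _) = cst (ip Om (fun x => coordf W i x - coordf G i x)
  (fun x => coordf W i x - coordf G i x))).
  by move=> h; apply: (cvg_unique _ _ h) => //; exact: cvg_cst.
apply/funext => n; rewrite ipBl// [RHS]ipBl//; congr (_ - _).
rewrite ipC [RHS]ipC (wgrad_ortho i wW qcell); last first.
  by apply: smooth_piecewise; apply: smooth_partial; case: (tphi n).
by rewrite (wgrad_ortho i wW qcell)//; exact: pwconst_piecewise.
Qed.

Lemma ipv_wgrad (Z : vec -> vec) : L2v Om Z -> ipv Om W Z = ipv Om G Z.
Proof.
move=> lZ; rewrite !ipv_sum//; apply: eq_bigr => i _.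
apply/eqP; rewrite -subr_eq0 -ipBl//; apply/eqP.
by apply: ip_null => //; exact: L2B (lW i) (lG i).
Qed.

(** Passing from W to G costs nothing in norm by [WG_null], and G has the pointwise bound of
    [pwconst_bound] on which [boundary_zero] relies. *)
Let grad_cvg : exists phi : nat -> vec -> R, [/\ forall n, test_fun Om (phi n),
  ip Om (fun x => q x - phi n x) (fun x => q x - phi n x) @[n --> \oo] --> (0 : R) &
  forall i, ip Om (fun x => partial i (phi n) x - coordf G i x)
       (fun x => partial i (phi n) x - coordf G i x) @[n --> \oo] --> (0 : R)].
Proof.
have [phi [tphi c1 c2]] := approx; exists phi; split => // i.
have lWG := L2B (lW i) (lG i).
have ld n := test_fun_L2 oOm bOm (test_fun_partial i (tphi n)).
rewrite (_ : (fun _ => _) = fun n =>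
  ip Om (fun x => coordf W i x - partial i (phi n) x)
      (fun x => coordf W i x - partial i (phi n) x)); first exact: c2.
apply/funext => n.
have lD := L2B (lW i) (ld n).
have E x : partial i (phi n) x - coordf G i x =
  (coordf W i x - coordf G i x) - (coordf W i x - partial i (phi n) x).
  by rewrite opprB [RHS]addrC subrKA.
rewrite (eq_ip (fun x _ => E x) (fun x _ => E x)).
exact: (ip_shift oOm lWG lD (WG_null i)).
Qed.

(** (G, curl Phi) = (W, curl Phi) = -(q, div curl Phi) = 0, where [curl Phi] is itself an admissible
    test field for the weak gradient. *)
Lemma pwconst_wcurl : is_wcurl Om G (fun=> 0).
Proof.
split=> [i|Phi tPhi].
  rewrite (_ : coordf _ _ = fun=> 0); first exact: cst_L2.
  by apply/funext => x; rewrite /coordf mxE.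
have tc := test_field_curl tPhi.
rewrite -ipv_wgrad//; last exact: (test_field_L2v oOm bOm tc).
have := wW.2 _ tc; rewrite divg_curl; last by move=> i; case: (tPhi i).
rewrite /ip Rintegral_eq0 => [|y _]; last by rewrite mulr0.
move=> /esym/eqP; rewrite oppr_eq0 => /eqP ->.
by rewrite /ipv Rintegral_eq0// => y _; rewrite dot0l.
Qed.

(** There are finitely many tetrahedra: those that contain x0 keep the bound nearby by continuity of
    their affine formula, and the others, being closed, avoid a neighbourhood of x0. *)
Let q_lower (x0 : vec) (c : R) : c < `|q x0| -> exists2 r, 0 < r &
  forall x, ball x0 r x -> Om x -> c <= `|q x|.
Proof.
move=> cq.
have : \forall x \near x0, forall K, tet (T K) x -> c < `|q x|.
  apply: (@filter_forall _ _ _ (nbhs x0)) => K.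
  have [xK|xK] := pselect (tet (T K) x0); last first.
    have : nbhs x0 (~` tet (T K)).
      apply: open_nbhs_nbhs; split => //; apply: closed_openC.
      exact: (tet_closed (nd K)).
    by apply: filterS => x nxK xK'.
  have cn : continuous (fun x => `|dot (a K) x + b K|).
    move=> x; apply: (@continuous_comp _ _ _ (fun z => dot (a K) z + b K) Num.norm).
      exact: affine_continuous.
    exact: norm_continuous.
  have nc : nbhs (`|dot (a K) x0 + b K|) [set s | c < s].
    by apply: open_nbhs_nbhs; split; [exact: open_gt|rewrite /= -qab].
  have H : nbhs x0 ((fun x => `|dot (a K) x + b K|) @^-1` [set s | c < s]).
    exact: (cn x0 _ nc).
  apply: filterS H => x /= cx xK'.
  by rewrite (qab xK').
move=> /nbhs_ballP[r /= r0 hr]; exists r => // x /hr xK /Om_tet[K Kx].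
exact/ltW/(xK K).
Qed.

(* Otherwise, changing one coordinate at a time, one could go from a point of Om
   to a point outside closure Om (conf_regular provides one) within Om. *)
Let axis_exit (x0 : vec) (r : R) : bdry Om x0 -> 0 < r -> exists u i t,
  [/\ Om u, box x0 (fun=> r) u, `|x0 0 i - t| < r & ~ closure Om (upd u i t)].
Proof.
move=> [clx0 nx0] r0; apply: contrapT => H.
have inside u i t : Om u -> box x0 (fun=> r) u -> `|x0 0 i - t| < r ->
    closure Om (upd u i t).
  by move=> Ou Qu xt; apply: contrapT => nc; apply: H; exists u, i, t.
(* [stay] improves [inside] from [closure Om] to [Om]. A point w near [upd u i t], with its i-th
   coordinate reset to that of u, lies in [Om] by openness, and [inside] brings it back to w. So
   [closure Om] contains a neighbourhood of [upd u i t], and [conf_regular] concludes. *)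
have stay u i t : Om u -> box x0 (fun=> r) u -> `|x0 0 i - t| < r ->
    Om (upd u i t).
  move=> Ou Qu xt; rewrite -(conf_regular hT).
  have : nbhs u (Om `&` ball x0 r).
    apply: filterI; first exact: open_nbhs_nbhs.
    by apply: open_nbhs_nbhs; split; [exact: ball_open|rewrite ball_box].
  move=> /nbhs_ballP[d /= d0 dO].
  pose e := Num.min d (r - `|x0 0 i - t|).
  have e0 : 0 < e by rewrite lt_min d0 subr_gt0.
  apply/nbhs_ballP; exists e => //= w; rewrite ball_box// => hw.
  have hi : `|t - w 0 i| < e by have := hw i; rewrite updE.
  have hj j : j != i -> `|u 0 j - w 0 j| < d.
    by move=> ji; have := hw j; rewrite mxE (negPf ji) lt_min => /andP[].
  have [Ow' Qw'] : (Om `&` ball x0 r) (upd w i (u 0 i)).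
    apply: dO; rewrite ball_box// => j; rewrite mxE; case: eqP => [->|/eqP].
      by rewrite subrr normr0.
    exact: hj.
  rewrite ball_box// in Qw'.
  rewrite -(upd_self w i) -(upd_upd w i (u 0 i)); apply: inside => //.
  apply: (le_lt_trans (ler_distD t _ _)); move: hi; rewrite lt_min => /andP[_].
  by rewrite ltrBrDl.
have [z [xz nz]] : exists z, ball x0 r z /\ ~ closure Om z.
  apply: contrapT => /forallNP nz; apply: nx0.
  rewrite (interior_id Om).1// -(conf_regular hT).
  apply: filterS (nbhsx_ballx x0 r r0) => x xb; apply: contrapT => nc.
  exact: (nz x).
have [y [Oy xy]] := clx0 _ (nbhsx_ballx x0 r r0).
rewrite ball_box// in xy; rewrite ball_box// in xz.
have Q u i t : box x0 (fun=> r) u -> `|x0 0 i - t| < r ->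
    box x0 (fun=> r) (upd u i t).
  by move=> Qu xt j; rewrite mxE; case: eqP => [->|_]; [exact: xt|exact: Qu].
have O1 := stay _ _ _ Oy xy (xz 0); have Q1 := Q _ _ _ xy (xz 0).
have O2 := stay _ _ _ O1 Q1 (xz 1); have Q2 := Q _ _ _ Q1 (xz 1).
have O3 := stay _ _ _ O2 Q2 (xz 2%:R).
apply: nz; apply: subset_closure; move: O3; congr (Om _).
by apply/rowP; apply: ord3P; rewrite !mxE.
Qed.

(* Test functions vanish at the outer end of the segment given by axis_exit, so
   their mean on a small box is at most 2 rho times that of their derivative on a
   longer one. In the H^1 limit a lower bound c > 0 of |q| near x0 would satisfy
   c <= 2 rho M, which fails for rho small. *)
Lemma boundary_zero (x0 : vec) : bdry Om x0 -> q x0 = 0.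
Proof.
move=> bx0; apply/eqP/negP => /negP q0.
have [clx0 nx0] := bx0.
pose c := `|q x0| / 2.
have c0 : 0 < c by rewrite divr_gt0// normr_gt0.
have [r r0 qr] : exists2 r, 0 < r & forall x, ball x0 r x -> Om x -> c <= `|q x|.
  by apply: q_lower; rewrite ltr_pdivrMr// ltr_pMr ?normr_gt0// ltr1n.
have [M M0 GM] := pwconst_bound a.
(* With [rho <= e], [M * (rho *+ 2)] is at most c/2 times M/(M+1), hence below c; the added 1 covers
   M = 0. *)
pose e : R := c / (4 * (M + 1)).
have M4 : 0 < 4 * (M + 1) by rewrite mulr_gt0// ltr_wpDl.
have e0 : 0 < e by rewrite divr_gt0.
pose rho : R := Num.min r e.
have rho0 : 0 < rho by rewrite lt_min r0.
have Mrho : M * (rho *+ 2) < c.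
  have ce : c = 4 * (M * e) + 4 * e.
    by rewrite -[c](@divfK _ (4 * (M + 1))) ?gt_eqF// -/e; ring.
  have re : M * rho <= M * e by rewrite ler_wpM2l// ge_min lexx orbT.
  have Me : 0 <= M * e by rewrite mulr_ge0// ltW.
  by rewrite mulr2n mulrDr ce; lra.
have [u [i [t [Ou Qu xt nw]]]] := axis_exit bx0 rho0.
have [d d0 [dB dw]] : exists2 d, 0 < d & box u (fun=> d) `<=` Om `&` box x0 (fun=> rho)
    /\ box (upd u i t) (fun=> d) `<=` ~` closure Om.
  have : nbhs u (Om `&` ball x0 rho).
    apply: filterI; first exact: open_nbhs_nbhs.
    by apply: open_nbhs_nbhs; split; [exact: ball_open|rewrite ball_box].
  move=> /nbhs_ballP[d1 /= d10 dO].
  have : nbhs (upd u i t) (~` closure Om).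
    by apply: open_nbhs_nbhs; split => //; apply: closed_openC; exact: closed_closure.
  move=> /nbhs_ballP[d2 /= d20 dN].
  exists (Num.min d1 d2); first by rewrite lt_min d10.
  split=> x xb.
    have [|Ox Qx] := dO x; last by rewrite ball_box// in Qx.
    by rewrite ball_box// => j; apply: lt_le_trans (xb j) _; rewrite ge_min lexx.
  apply: dN; rewrite ball_box// => j; apply: lt_le_trans (xb j) _.
  by rewrite ge_min lexx orbT.
have us s : `|u 0 i - s| < d -> `|x0 0 i - s| < rho.
  move=> hs; have [_ /(_ i)] : (Om `&` box x0 (fun=> rho)) (upd u i s).
    apply: dB => j; rewrite mxE; case: eqP => [->//|_].
    by rewrite subrr normr0.
  by rewrite updE.
have [phi [tphi cA cB]] := grad_cvg.
pose A n := ip Om (fun x => q x - phi n x) (fun x => q x - phi n x).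
pose B n := ip Om (fun x => partial i (phi n) x - coordf G i x)
       (fun x => partial i (phi n) x - coordf G i x).
(* Half-lengths of the long box L: centred at [x0 0 i] in direction i, it covers the range of the
   small box and the exit point t, both within [rho] of x0. In [VLE] the factor [d *+ 2] of the
   Poincaré estimate becomes [rho *+ 2], so that d, which cannot be controlled, disappears from the
   main term. *)
pose ec (j : 'I_3) := if j == i then rho else d.
pose V := \prod_(j < 3) (d *+ 2); pose VL := \prod_j (ec j *+ 2).
have V0 : 0 < V by apply: prodr_gt0 => j _; rewrite mulrn_wgt0.
have VLE : d *+ 2 * VL = rho *+ 2 * V.
  rewrite /VL /V (bigD1 i)//= [in RHS](bigD1 i)//= /ec eqxx mulrCA; congr (_ * (_ * _)).
  by apply: eq_bigr => j /negPf ->.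
have ec0 j : 0 < ec j by rewrite /ec; case: eqP.
have lq : L2 Om q by case: Hq => -[[]].
have lphi n := test_fun_L2 oOm bOm (tphi n).
have ld n := test_fun_L2 oOm bOm (test_fun_partial i (tphi n)).
set PB := (@pt R : X -> vec) @^-1` box u (fun=> d).
pose L : set vec := box (upd u i (x0 0 i)) ec.
set PL := (@pt R : X -> vec) @^-1` L.
have mB : measurable PB := measurable_pt_box _ _.
have mL : measurable PL := measurable_pt_box _ _.
have mOm : measurable ((@pt R : X -> vec) @^-1` Om) by exact: pt_measurable.
have lebB : leb3 PB = V%:E by rewrite leb3_box.
have lebL : leb3 PL = VL%:E by rewrite leb3_box.
have BOm : box u (fun=> d) `<=` Om by move=> x /dB[].
(* On the small box |q| is at most |q - phi n| + |phi n|. The first term is bounded by [L1_le] with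
   parameter k, the second by the derivative on L, which is compared in turn with G. *)
have main n k : 0 < k -> c * V <= k * V + k^-1 * A n
    + d *+ 2 * ((M + k) * VL + k^-1 * B n).
  move=> k0.
  have sphi : smooth (phi n) by case: (tphi n).
  have phi_out x : ~ Om x -> phi n x = 0.
    by case: (tphi n) => _ [S [_ SOm S0]] nx; apply: S0 => /SOm.
  have dphi_out x : ~ Om x -> partial i (phi n) x = 0.
    have [_ [S [_ SOm S0]]] := test_fun_partial i (tphi n).
    by move=> nx; apply: S0 => /SOm.
  have f0 : box (upd u i t) (fun=> d) `<=` [set x | phi n x = 0].
    by move=> x /dw nx; apply: phi_out => /subset_closure.
  have h1 := le_integral_box sphi d0 xt us f0.
  have mfB (f : vec -> R) : L2 Om f -> measurable_fun PB (fun y : X => `|f (pt y)|%:E).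
    move=> lf; apply/measurable_EFinP/measurableT_comp => //.
    apply: (measurable_funS mOm _ (L2_measurable oOm lf)).
    by move=> y /BOm.
  have i1 : ((c * V)%:E <= \int[@leb3 R]_(y in PB) `|q (pt y)|%:E)%E.
    rewrite EFinM -lebB -integral_cst//; apply: ge0_le_integral => //.
    - by move=> y _; rewrite lee_fin ltW.
    - exact: mfB.
    move=> y /dB[Oy Qy]; rewrite lee_fin; apply: qr => //.
    rewrite ball_box// => j; apply: lt_le_trans (Qy j) _.
    by rewrite ge_min lexx.
  have i2 : (\int[@leb3 R]_(y in PB) `|q (pt y)|%:E <=
      \int[@leb3 R]_(y in PB) `|q (pt y) - phi n (pt y)|%:E
      + \int[@leb3 R]_(y in PB) `|phi n (pt y)|%:E)%E.
    have m1 := mfB _ (L2B lq (lphi n)); have m2 := mfB _ (lphi n).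
    rewrite -ge0_integralD//; apply: ge0_le_integral => //.
    - exact: mfB.
    - exact: emeasurable_funD.
    move=> y _; rewrite -EFinD lee_fin.
    by rewrite -[X in `|X| <= _](subrK (phi n (pt y))) ler_normD.
  have i3 := L1_le oOm (L2B lq (lphi n)) BOm mB k0.
  have mLO : measurable (PL `&` (@pt R : X -> vec) @^-1` Om) by exact: measurableI.
  have i4 : (\int[@leb3 R]_(y in PL) `|partial i (phi n) (pt y)|%:E <=
      ((M + k) * VL + k^-1 * B n)%:E)%E.
    (* L may leave [Om], where the comparison with G says nothing; there the derivative of the test
       function is 0. *)
    have -> : (\int[@leb3 R]_(y in PL) `|partial i (phi n) (pt y)|%:E =
        \int[@leb3 R]_(y in PL `&` (@pt R : X -> vec) @^-1` Om)
          `|partial i (phi n) (pt y)|%:E)%E.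
      rewrite integral_mkcond [RHS]integral_mkcond; apply: eq_integral => y _.
      rewrite /patch in_setI; case: ifPn => //= _; case: ifPn => // /negP yO.
      by rewrite dphi_out ?normr0// => Oy; apply: yO; rewrite inE.
    have i5 : (\int[@leb3 R]_(y in @pt R @^-1` (L `&` Om)) `|partial i (phi n) (pt y)|%:E <=
        (M + k)%:E * leb3 ((@pt R : X -> vec) @^-1` (L `&` Om))
        + (k^-1 * B n)%:E)%E.
      apply: (integral_norm_le oOm (ld n) (L2B (ld n) (lG i))) => //.
      move=> x _; apply: (@le_trans _ _ (`|coordf G i x| + `|partial i (phi n) x - coordf G i x|)).
        by rewrite -[X in `|X| <= _](subrK (coordf G i x)) addrC ler_normD.
      by rewrite lerD2r; exact: GM.
    apply: (le_trans i5); rewrite [X in (_ <= X)%E]EFinD; apply: leeD2r.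
    rewrite [X in (_ <= X)%E]EFinM; apply: lee_wpmul2l.
      by rewrite lee_fin addr_ge0// (ltW k0).
    by rewrite -lebL; apply: le_measure; rewrite ?inE//; exact: subIsetl.
  have i6 : (\int[@leb3 R]_(y in PL) (d *+ 2 * `|partial i (phi n) (pt y)|)%:E <=
      (d *+ 2 * ((M + k) * VL + k^-1 * B n))%:E)%E.
    have d20 : (0 <= (d *+ 2)%:E :> \bar R)%E by rewrite lee_fin mulrn_wge0// ltW.
    under eq_integral do rewrite EFinM.
    rewrite ge0_integralZl//; first by rewrite EFinM lee_wpmul2l.
    apply/measurable_EFinP/measurableT_comp => //; apply: measurable_funTS.
    exact: (pt_measurable_fun (smoothC (smooth_partial i sphi))).
  rewrite -lee_fin; apply: (le_trans i1); apply: (le_trans i2).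
  rewrite EFinD; apply: leeD; last exact: (le_trans h1 i6).
  by apply: (le_trans i3); rewrite lebB -EFinM -EFinD.
pose del : R := (c - M * (rho *+ 2)) * V.
have del0 : 0 < del by rewrite mulr_gt0// subr_gt0.
have r1 : 0 < 1 + rho *+ 2 by rewrite addr_gt0// mulrn_wgt0.
(* The terms in k then use up exactly half of the gap [del], and the other half bounds
   [A n + d *+ 2 * B n] from below independently of n. *)
pose k : R := del / (2 * (V * (1 + rho *+ 2))).
have k0 : 0 < k by rewrite divr_gt0// !mulr_gt0.
have kV : k * V * (1 + rho *+ 2) = del / 2.
  by rewrite -mulrA /k invfM [del * (_ * _)]mulrA divfK// mulf_neq0// gt_eqF.
have low n : k * del / 2 <= A n + d *+ 2 * B n.
  have := main n k k0; rewrite mulrDr [d *+ 2 * ((M + k) * VL)]mulrCA VLE => h.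
  have h' : del / 2 <= k^-1 * (A n + d *+ 2 * B n).
    have E1 : c * V - (M + k) * (rho *+ 2 * V) - k * V = del / 2.
      have -> : del / 2 = del - k * V * (1 + rho *+ 2) by rewrite kV; field.
      by rewrite /del; ring.
    by rewrite -E1 mulrDr [k^-1 * (d *+ 2 * _)]mulrCA; lra.
  by rewrite -mulrA -ler_pdivlMl.
have cAB : (A n + d *+ 2 * B n) @[n --> \oo] --> (0 : R).
  have -> : (0 : R) = 0 + d *+ 2 * 0 by rewrite mulr0 addr0.
  by apply: cvgD cA _; apply: cvgMr; exact: cB.
have pos : 0 < k * del / 2 by rewrite divr_gt0// mulr_gt0.
have /cvgrPdist_lt/(_ _ pos) [n _ /(_ n (leqnn n))] := cAB.
rewrite sub0r normrN => /(le_lt_trans (ler_norm _)).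
by rewrite ltNge low.
Qed.

(** A zero norm gives zero only almost everywhere; [q_lower] spreads a nonzero value over a box of
    positive volume. *)
Lemma ip_self_eq0 : ip Om q q = 0 -> forall x, Om x -> q x = 0.
Proof.
move=> q2 x Ox; apply/eqP/negP => /negP q0.
pose c := `|q x| / 2.
have c0 : 0 < c by rewrite divr_gt0// normr_gt0.
have [r r0 qr] : exists2 r, 0 < r & forall z, ball x r z -> Om z -> c <= `|q z|.
  by apply: q_lower; rewrite ltr_pdivrMr// ltr_pMr ?normr_gt0// ltr1n.
have : nbhs x (Om `&` ball x r).
  by apply: filterI; [exact: open_nbhs_nbhs|exact: nbhsx_ballx].
move=> /nbhs_ballP[d /= d0]; rewrite ball_box// => dB.
have lq : L2 Om q by case: Hq => -[[]].
set PB := (@pt R : X -> vec) @^-1` box x (fun=> d).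
have mB : measurable PB := measurable_pt_box _ _.
have BOm : box x (fun=> d) `<=` Om by move=> z /dB[].
pose V := \prod_(j < 3) (d *+ 2).
have V0 : 0 < V by apply: prodr_gt0 => j _; rewrite mulrn_wgt0.
have lebB : leb3 PB = V%:E by rewrite leb3_box.
(* Used as the parameter of [L1_le], c/2 gives the contradiction c V <= (c/2) V. *)
have c2 : 0 < c / 2 by rewrite divr_gt0.
have := L1_le oOm lq BOm mB c2; rewrite q2 mulr0 adde0 lebB.
have : ((c * V)%:E <= \int[@leb3 R]_(y in PB) `|q (pt y)|%:E)%E.
  rewrite EFinM -lebB -integral_cst//; apply: ge0_le_integral => //.
  - by move=> y _; rewrite lee_fin ltW.
  - apply/measurable_EFinP/measurableT_comp => //.
    by apply: (measurable_funS (pt_measurable oOm) _ (L2_measurable oOm lq)) => y /BOm.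
  by move=> y /dB[Oy Qy]; rewrite lee_fin; exact: qr.
move=> h1 h2; have := le_trans h1 h2; rewrite -EFinM lee_fin.
by rewrite ler_pM2r// leNgt ltr_pdivrMr// ltr_pMr// ltr1n.
Qed.

End DiscretePotential.

End Elements.

(** * The admissible test field and one time step *)

Section Scheme.
Variables (R : realType) (Om Gi : set 'rV[R]_3).
Variables (I : finType) (T : I -> 'I_4 -> 'rV[R]_3) (h : 'rV[R]_3 -> R).
Hypotheses (hOm : shell Om Gi) (hT : conforming Om T).
Hypothesis hh : discrete_harmonic Om Gi T h.
Local Notation vec := 'rV[R]_3.
Local Notation cell K := ((tet (T K))°).

Let oOm : open Om. Proof. exact: shell_open hOm. Qed.
Let bOm : bounded_set Om. Proof. exact: shell_bounded hOm. Qed.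
Let nd K : Defs.nondegenerate (T K). Proof. exact: conf_nondegenerate hT K. Qed.

(** If f has no weak gradient, [get] returns the default point, a constant field, which is in L^2 as
    [Om] is bounded. This covers the harmonic form h, whose definition does not provide a weak
    gradient. *)
Let wgrad_L2v (f : vec -> R) : L2v Om (wgrad Om f).
Proof.
rewrite /wgrad; have [ex|nex] := pselect (exists W, is_wgrad Om f W).
  by have [] := getPex ex.
rewrite getPN; last by move=> W wW; apply: nex; exists W.
by move=> i; exact: (cst_L2 oOm ((point : vec) 0 i) bOm).
Qed.

Lemma H0_grad_coef (q : vec -> R) : H0_grad Om T q -> exists a b,
  forall (K : I) x, tet (T K) x -> q x = dot (a K) x + b K.
Proof.
move=> [_ aff].
have /choice[ab abP] : forall K, exists ab : vec * R,
    forall x, tet (T K) x -> q x = dot ab.1 x + ab.2.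
  by move=> K; have [a [b qab]] := aff K; exists (a, b).
by exists (fun K => (ab K).1), (fun K => (ab K).2).
Qed.

Section Potential.
Variables (q : vec -> R) (a : I -> vec) (b : I -> R).
Hypotheses (Hq : H0_grad Om T q).
Hypothesis (qab : forall K x, tet (T K) x -> q x = dot (a K) x + b K).
Let G := pwconst T a.

Lemma trace_pwconst K i : face (T K) i `<=` bdry Om ->
  forall x, face (T K) i x ->
  cross (inner_trace (T K) G x) (face_normal (T K) i) = 0.
Proof.
move=> fb x fx.
rewrite (inner_trace_cst (nd K) (@pwconst_cell _ _ _ _ hT a K) (face_tet (nd K) fx)).
apply: (cross_face_normal0 (nd K) (b := b K)) => z fz.
rewrite -(qab (face_tet (nd K) fz)).
exact: (boundary_zero hOm hT Hq qab (fb _ fz)).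
Qed.

Lemma pwconst_Himp_curl : Himp_curl Om Gi T h G.
Proof.
split; last first.
  rewrite -(ipv_wgrad hOm hT Hq qab); last exact: wgrad_L2v.
  by rewrite ipvC; case: hh => _ _ _ _; exact.
split.
- split; first exact: (pwconst_L2v T hOm).
  by exists (fun=> 0); exact: (pwconst_wcurl hOm hT Hq qab).
- move=> K i x fG fx; apply: trace_pwconst => //.
  by move=> z /fG[].
move=> K; exists (a K), 0 => x xK.
rewrite /G (pwconst_cell hT a xK) (_ : cross 0 x = 0) ?addr0//.
by apply/rowP => j; rewrite !mxE !mul0r subr0.
Qed.

Let Gi_bdry : Gi `<=` bdry Om.
Proof.
move=> x Gx; have := Gx; rewrite -{1}(shell_inner_component hOm Gx).
exact: connected_component_sub.
Qed.

Lemma impedance_pwconst E : impedance Gi T E G = 0.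
Proof.
rewrite /impedance big1// => -[K i] /= /asboolP fG.
rewrite /face_integral Rintegral_eq0 ?mulr0// => y [y1 y2 y12].
set x := _ + _ *: _ + _.
have fx : face (T K) i x by exact: (face_param (nd K)).
have E0 := trace_pwconst (subset_trans fG Gi_bdry) fx.
rewrite (_ : cross _ (inner_trace _ G _) = 0) ?dot0r//.
apply/rowP => j; have /rowP/(_ j) := E0; rewrite !mxE => e.
by rewrite -[RHS]oppr0 -e opprB; congr (_ - _); rewrite mulrC.
Qed.

(** The representative [wcurl Om G] need not be 0 pointwise. It is orthogonal to all test functions,
    and B is piecewise affine, so [ortho_piecewise] applies to each component. *)
Lemma wcurl_pwconst (B : vec -> vec) : L2v Om B ->
  (forall K, exists c (beta : R), forall x, cell K x -> B x = c + beta *: x) ->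
  ipv Om B (wcurl Om G) = 0.
Proof.
move=> lB hB.
have wc : is_wcurl Om G (wcurl Om G).
  have ex : exists Z, is_wcurl Om G Z.
    by exists (fun=> 0); exact: (pwconst_wcurl hOm hT Hq qab).
  exact: (getPex ex).
have [lZ wZ] := wc; have [_ w0] := pwconst_wcurl hOm hT Hq qab.
rewrite ipv_sum// big1// => i _; rewrite ipC.
apply: (ortho_piecewise hOm hT) => //.
  split; first exact: lB.
  move=> K; have [c [beta cb]] := hB K.
  exists (fun x => dot (beta *: delta_mx 0 i) x + c 0 i).
    exact: smooth_affine.
  move=> x xK; rewrite /coordf (cb _ xK) !mxE dotC dotZr dot_delta addrC.
  by [].
move=> K phi tphi.
have tf := test_field_single i (test_fun_sub (cell_Om hT (K := K)) tphi).
rewrite -ipv_single -(wZ _ tf) (w0 _ tf).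
by rewrite /ipv Rintegral_eq0// => y _; rewrite dot0l.
Qed.

End Potential.

Section Step.
Variables (gamma tau : R) (E0 B0 E1 B1 : vec -> vec) (p0 p1 : vec -> R).
Hypotheses (htau : 0 < tau)
  (hE0 : Himp_curl Om Gi T h E0) (hB0 : Himp_div Om Gi T B0)
  (hE1 : Himp_curl Om Gi T h E1) (hB1 : Himp_div Om Gi T B1)
  (hp1 : H0_grad Om T p1)
  (scheme : crank_nicolson_step Om Gi T h gamma tau E0 B0 p0 E1 B1 p1)
  (p00 : forall x, Om x -> p0 x = 0)
  (E00 : forall q, H0_grad Om T q -> ipv Om E0 (wgrad Om q) = 0).

Let lE0 : L2v Om E0. Proof. by case: hE0 => -[[]]. Qed.
Let lE1 : L2v Om E1. Proof. by case: hE1 => -[[]]. Qed.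
Let lB0 : L2v Om B0. Proof. by case: hB0 => -[]. Qed.
Let lB1 : L2v Om B1. Proof. by case: hB1 => -[]. Qed.
Let pm : vec -> R := fun x => 2^-1 * (p1 x + p0 x).

Let pmE x : Om x -> pm x = 2^-1 * p1 x.
Proof. by move=> Ox; rewrite /pm p00// addr0. Qed.

(** In [Om] the average is half of p1, so half of a weak gradient of p1 is one for [pm]; existence
    is what makes the chosen [wgrad Om pm] a genuine weak gradient. *)
Let wpm : is_wgrad Om pm (wgrad Om pm).
Proof.
have [W [lW wW]] : exists W, is_wgrad Om p1 W by case: hp1 => -[[]].
have ex : exists V, is_wgrad Om pm V.
  exists (fun x => 2^-1 *: W x); split.
    move=> i; apply: (@eq_L2 _ _ (fun x => 2^-1 * coordf W i x)).
      by move=> x _; rewrite /coordf mxE.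
    exact: L2Z.
  move=> Phi tPhi.
  have lPhi := test_field_L2v oOm bOm tPhi.
  have -> : ip Om pm (divg Phi) = ip Om (fun x => 2^-1 * p1 x) (divg Phi).
    exact: eq_ip.
  have lp1 : L2 Om p1 by case: hp1 => -[[]].
  have ldiv : L2 Om (divg Phi).
    rewrite (_ : divg Phi = fun x => partial 0 (coordf Phi 0) x
      + partial 1 (coordf Phi 1) x + partial 2%:R (coordf Phi 2%:R) x).
      have ld i := test_fun_L2 oOm bOm (test_fun_partial i (tPhi i)).
      exact: L2D (L2D (ld 0) (ld 1)) (ld 2%:R).
    by apply/funext => x; rewrite /divg sum3.
  by rewrite ipZl// (wW _ tPhi) mulrN ipvZl.
exact: (getPex ex).
Qed.

Let scheme_E q : H0_grad Om T q -> forall a b, (forall K x, tet (T K) x -> q x = dot (a K) x + b K) ->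
  tau^-1 * ipv Om E1 (wgrad Om q) = - ipv Om (wgrad Om pm) (pwconst T a).
Proof.
move=> Hq a b qab.
have HG := pwconst_Himp_curl Hq qab.
have lG := pwconst_L2v T hOm a.
have [e1 _ _] := scheme HG hB1 Hq.
move: e1; rewrite (impedance_pwconst Hq qab) mulr0 subr0.
rewrite (wcurl_pwconst Hq qab) ?addr0; last first.
- move=> K; have [_ _ /(_ K)[c1 [b1 h1]]] := hB1.
  have [_ _ /(_ K)[c0 [b0 h0]]] := hB0.
  exists (2^-1 *: (c1 + c0)), (2^-1 * (b1 + b0)) => x xK.
  rewrite h1// h0// -scalerA -scalerDr; congr (_ *: _).
  by rewrite scalerDl addrACA.
- exact: L2v_mid.
rewrite ipvBl// [ipv Om E0 _]ipvC [ipv Om E1 _]ipvC.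
rewrite -!(ipv_wgrad hOm hT Hq qab)// [X in _ - X]ipvC (E00 Hq) subr0 => <-.
by rewrite ipvC.
Qed.

Let p10 : forall x, Om x -> p1 x = 0.
Proof.
have [a [b qab]] := H0_grad_coef hp1.
apply: (ip_self_eq0 hOm hT hp1 qab).
have lG := pwconst_L2v T hOm a.
have lp1 : L2 Om p1 by case: hp1 => -[[]].
have e1 := scheme_E hp1 qab.
have HG := pwconst_Himp_curl hp1 qab.
have [_ _ e3] := scheme HG hB1 hp1.
move: e3; rewrite (ipv_mid oOm 2^-1 lE1 lE0 (wgrad_L2v p1)).
rewrite (E00 hp1) addr0.
have -> : ip Om (p1 \- p0) p1 = ip Om p1 p1.
  by apply: eq_ip => // x Ox; rewrite /= p00// subr0.
have pmab K x : cell K x -> pm x = dot (2^-1 *: a K) x + 2^-1 * b K.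
  move=> xK; rewrite pmE; last exact: (cell_Om hT xK).
  by rewrite (qab K x (interior_subset xK)) [in RHS]dotC dotZr [dot x _]dotC mulrDr.
move: e1; rewrite (ipv_wgrad_pwconst hOm hT _ wpm pmab).
have -> : ipv Om (pwconst T (fun K => 2^-1 *: a K)) (pwconst T a) =
    2^-1 * ipv Om (pwconst T a) (pwconst T a).
  rewrite -ipvZl//; apply: eq_Rintegral => y _; congr (dot _ _).
  rewrite /pwconst scaler_sumr; apply: eq_bigr => K _.
  by rewrite !scalerA mulrC.
set x := ipv Om E1 _; set y := ip Om p1 p1; set g := ipv Om _ _.
have y0 : 0 <= y by exact: ip_ge0.
have g0 : 0 <= g by rewrite /g ipv_sum//; apply: sumr_ge0 => i _; exact: ip_ge0.
move=> e1 e3.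
have xE : x = - (tau * (2^-1 * g)) by rewrite -mulrN -e1 mulVKf ?gt_eqF.
have yE : y = tau * (2^-1 * x) by rewrite -e3 mulVKf ?gt_eqF.
apply/eqP; rewrite eq_le y0 andbT yE xE !mulrN oppr_le0.
by rewrite !mulr_ge0// ltW.
Qed.

Lemma step_invariant : (forall x, Om x -> p1 x = 0) /\
  (forall q, H0_grad Om T q -> ipv Om E1 (wgrad Om q) = 0).
Proof.
split; first exact: p10.
move=> q Hq; have [a [b qab]] := H0_grad_coef Hq.
have := scheme_E Hq qab.
(* Since p1 now vanishes in [Om], the average has cellwise gradient 0, which removes the right-hand
   side of [scheme_E] for every q. *)
have pm0 K x : cell K x -> pm x = dot (0 : vec) x + 0.
  by move=> xK; have Ox := cell_Om hT xK; rewrite pmE// p10// mulr0 dot0l addr0.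
rewrite (@ipv_wgrad_pwconst _ _ _ _ _ hOm hT _ _ (fun=> 0) a (fun=> 0) wpm pm0).
rewrite (_ : pwconst T (fun=> 0) = fun=> 0); last first.
  by apply/funext => x; rewrite /pwconst big1// => K _; rewrite scaler0.
rewrite {2}/ipv Rintegral_eq0; last by move=> y _; rewrite dot0l.
move=> /eqP; rewrite oppr0 mulf_eq0 invr_eq0 (gt_eqF htau) => /eqP.
exact.
Qed.

End Step.
End Scheme.

Theorem lemma5p1 (R : realType) (Om Gi : set 'rV[R]_3)
    (I : finType) (T : I -> 'I_4 -> 'rV[R]_3) (h : 'rV[R]_3 -> R)
    (gamma tau : R) (N : nat)
    (E B : nat -> 'rV[R]_3 -> 'rV[R]_3) (p : nat -> 'rV[R]_3 -> R)
    (hOm : shell Om Gi) (hT : conforming Om T)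
    (hh : discrete_harmonic Om Gi T h)
    (hgamma : 0 < gamma) (htau : 0 < tau) (hN : (1 <= N)%N)
    (hspaces : forall k, (k <= N)%N ->
      [/\ Himp_curl Om Gi T h (E k), Himp_div Om Gi T (B k)
        & H0_grad Om T (p k)])
    (hscheme : forall k, (1 <= k <= N)%N ->
      crank_nicolson_step Om Gi T h gamma tau
        (E k.-1) (B k.-1) (p k.-1) (E k) (B k) (p k))
    (hp0 : forall x, Om x -> p 0%N x = 0)
    (hE0 : forall q, H0_grad Om T q -> ipv Om (E 0%N) (wgrad Om q) = 0) :
  forall k, (k <= N)%N ->
    (forall x, Om x -> p k x = 0) /\
    (forall q, H0_grad Om T q -> ipv Om (E k) (wgrad Om q) = 0).
Proof.
elim=> [//|k IHk kN]; have [pk Ek] := IHk (ltnW kN).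
have [e0 b0 _] := hspaces _ (ltnW kN); have [e1 b1 p1] := hspaces _ kN.
exact: (step_invariant hOm hT hh htau e0 b0 e1 b1 p1 (hscheme k.+1 kN) pk Ek).
Qed.
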